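(* Suppose that the model parameters $\boldsymbol{\beta}$, $\mu_i$ and $\sigma_{i}$ are known. Under Assumption 1, \begin{align*} CD &= \sqrt{\frac{2}{TN(N-1)}}\sum_{i=2}^{N} \sum_{j=1}^{i-1}\sum_{t=1}^{T}\varepsilon_{i,t}\varepsilon_{j,t}\left(\sigma_{i}^{-1}-\overline{\sigma^{-1}}\right)\left(\sigma_{j}^{-1}-\overline{\sigma^{-1}}\right) +\sqrt{T}\, \Xi + O_{P}(\sqrt{T}N^{-1}), \end{align*} where \begin{align*} \Xi &= \sqrt{\frac{N}{2(N-1)}} \frac{1}{NT}\sum_{i=1}^{N}\sum_{t=1}^{T} \varepsilon_{i,t}^{2}\left(\left(\overline{\sigma^{-1}}\right)^{2} - 2\overline{\sigma^{-1}}\sigma_{i}^{-1} \right). \end{align*} Furthermore, let $\Omega = \left(1-2\mathbb{E}[\sigma_{i}]\mathbb{E}[\sigma_{i}^{-1}] + \mathbb{E}[\sigma_{i}^{2}](\mathbb{E}[\sigma_{i}^{-1}])^{2}\right)^2$. Then \begin{equation*} CD - \sqrt{T}\,\Xi \xrightarrow{d} N\left(0, \Omega \right) \end{equation*} as $N,T\to \infty$ jointly subject to the restriction $\sqrt{T}N^{-1} \to 0$.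
   Context: Panel model with additive time effects: $y_{i,t} = \mathbf{x}_{i,t}'\boldsymbol{\beta} + \tau_t + \mu_i + \varepsilon_{i,t}$, $i=1,\dots,N$, $t=1,\dots,T$, where $\mu_i$ is an entity-specific intercept and $\tau_t$ a time-specific common parameter. With $\boldsymbol{\beta}$ and $\mu_i$ known (w.l.o.g. $\boldsymbol{\beta}=\mathbf{0}$, $\mu_i=0$), the model reduces to $y_{i,t}=\tau_t+\varepsilon_{i,t}$; the time effects are estimated by $\hat\tau_t=\overline{y}_t=N^{-1}\sum_{i=1}^N y_{i,t}$ and residuals are $\hat\varepsilon_{i,t}=y_{i,t}-\hat\tau_t=\varepsilon_{i,t}-\overline{\varepsilon}_t$. The CD statistic (standardized with the known $\sigma_i$) is $CD=\sqrt{\frac{2}{TN(N-1)}}\sum_{i=2}^N\sum_{j=1}^{i-1}\sum_{t=1}^T \hat\varepsilon_{i,t}\hat\varepsilon_{j,t}/(\sigma_i\sigma_j)$. Notation: $\overline{\sigma^{k}}=N^{-1}\sum_{i=1}^N\sigma_i^k$. Assumption 1: (1) $\varepsilon_{i,t}=\sigma_i\eta_{i,t}$ where $\eta_{i,t}$ is i.i.d. across $i$ and $t$ with $\mathbb{E}[\eta_{i,t}]=0$, $\mathbb{E}[\eta_{i,t}^2]=1$, $\mathbb{E}[\eta_{i,t}^8]<M<\infty$; (2) $\sigma_i$ takes values in $[\delta,M]$ with $0<\delta<M<\infty$, is i.i.d. across $i$, and is independent of $\eta_{i,t}$ for all $i,t$. *)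

(* Defs.v *)
From HB Require Import structures.
From mathcomp Require Import all_boot all_order all_algebra.
From mathcomp Require Import all_classical all_reals all_analysis.
Set Implicit Arguments. Unset Strict Implicit. Unset Printing Implicit Defensive.
Import Order.TTheory GRing.Theory Num.Theory.
Import numFieldNormedType.Exports.
Local Open Scope classical_set_scope.
Local Open Scope ring_scope.

Section defs.
Context {R : realType} {d : measure_display} {Om : measurableType d}.

Definition mutually_independent (P : probability Om R) {I : eqType}
    (X : I -> Om -> R) : Prop :=
  forall (s : seq I) (B : I -> set R), uniq s -> (forall i, measurable (B i)) ->
  P (\bigcap_(i in [set` s]) (X i @^-1` B i)) = (\prod_(i <- s) P (X i @^-1` B i))%E.

Definition ident_distr (P : probability Om R) (X Y : Om -> R) : Prop :=
  forall B : set R, measurable B -> P (X @^-1` B) = P (Y @^-1` B).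

Definition Ex (P : probability Om R) (X : Om -> R) : R :=
  fine (\int[P]_w (X w)%:E)%E.

(* Model quantities; indices are 0-based: i < N, t < T. *)
Definition epsilon (sigma : nat -> Om -> R) (eta : nat -> nat -> Om -> R)
  (i t : nat) (w : Om) : R := sigma i w * eta i t w.

(* observations y_{i,t} = tau_t + eps_{i,t} (beta = 0, mu_i = 0 known) *)
Definition yobs (tau : nat -> R) sigma eta (i t : nat) (w : Om) : R :=
  tau t + epsilon sigma eta i t w.

Definition tauhat (N : nat) tau sigma eta (t : nat) (w : Om) : R :=
  (N%:R)^-1 * \sum_(j < N) yobs tau sigma eta j t w.

Definition resid (N : nat) tau sigma eta (i t : nat) (w : Om) : R :=
  yobs tau sigma eta i t w - tauhat N tau sigma eta t w.

Definition CDstat (N T : nat) tau sigma eta (w : Om) : R :=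
  Num.sqrt (2 / (T%:R * N%:R * (N%:R - 1))) *
  \sum_(i < N) \sum_(j < i) \sum_(t < T)
     (resid N tau sigma eta i t w * resid N tau sigma eta j t w
       / (sigma i w * sigma j w)).

Definition sinvbar (N : nat) (sigma : nat -> Om -> R) (w : Om) : R :=
  (N%:R)^-1 * \sum_(i < N) (sigma i w)^-1.

Definition CDlead (N T : nat) sigma eta (w : Om) : R :=
  Num.sqrt (2 / (T%:R * N%:R * (N%:R - 1))) *
  \sum_(i < N) \sum_(j < i) \sum_(t < T)
     (epsilon sigma eta i t w * epsilon sigma eta j t w
       * ((sigma i w)^-1 - sinvbar N sigma w)
       * ((sigma j w)^-1 - sinvbar N sigma w)).

Definition Xi (N T : nat) sigma eta (w : Om) : R :=
  Num.sqrt (N%:R / (2 * (N%:R - 1))) * (N%:R * T%:R)^-1 *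
  \sum_(i < N) \sum_(t < T)
     (epsilon sigma eta i t w ^+ 2 *
        (sinvbar N sigma w ^+ 2 - 2 * sinvbar N sigma w * (sigma i w)^-1)).

(* E[f(Z)] for Z ~ N(0, v), v >= 0 (v = 0: point mass at 0). *)
Definition normal_expect (v : R) (f : R -> R) : \bar R :=
  if v == 0 then (f 0)%:E
  else (\int[normal_prob 0 (Num.sqrt v)]_x (f x)%:E)%E.

Definition cvg_in_distr_normal (P : probability Om R) (X : nat -> Om -> R)
    (v : R) : Prop :=
  forall f : R -> R, continuous f -> (exists C : R, forall x, `|f x| <= C) ->
  ((fun k => \int[P]_w (f (X k w))%:E)%E @ \oo --> normal_expect v f).

End defs.

(* Main.v *)
Require Import Defs.
From HB Require Import structures.
From mathcomp Require Import all_boot all_order all_algebra.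
From mathcomp Require Import all_classical all_reals all_analysis.
From mathcomp Require Import measurable_realfun ring lra.
Set Implicit Arguments. Unset Strict Implicit. Unset Printing Implicit Defensive.
Import Order.TTheory GRing.Theory Num.Theory.
Import numFieldNormedType.Exports.
Local Open Scope classical_set_scope.
Local Open Scope ring_scope.

(** Write [mean] for the average of the [1 / sigma_i]. Since the [resid_it / sigma_i]
    and the [eps_it * (1 / sigma_i - mean)] have the same sum over [i], the
    difference [CD - lead - sqrt T * Xi] is [cdscale] times a sum over [t] of
    products of linear forms in [eta_.t]; each product is bounded in L^1, and
    Markov's inequality gives the [O_P] bound.

    The lead term is [W = c * sum_(t < T) Q_t] with
    [Q_t = sum_(j < i) g_i g_j eta_it eta_jt] and [g_i = 1 - sigma_i * mean].
    The [Q_t] share the random weights [g_i] but are orthogonal, and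
    [E Q_t^4 = O(N^4)], so Stein's method applies as in a row-wise i.i.d.
    array: [E (W f(W)) ~ E (v f'(W))], where [v] is the conditional variance of
    [W] given [sigma], which tends to [Omega] by the law of large numbers
    for [1 / sigma], [sigma] and [sigma^2].

    Only test functions [f] that are C^1 with compact support are needed: if
    [h] is continuous with compact support and has mean zero under N(0, s^2),
    the solution of [s^2 f' - x f = h] is compactly supported, which makes the
    usual bounds on Stein solutions superfluous. A bounded continuous [g] is
    brought to this form by subtracting a multiple of a cutoff function from
    its truncation, the error being controlled by [E W^2]. *)

(** * Expectations and absolute moments *)

(** All weights [g_i] contain the average of the [1 / sigma_j], so neither the [g_i] nor the [Q_t]
    need be independent. Conditioning on [sigma] is replaced by one device: each [eta_it] is
    independent of the sigma-algebra generated by all the other variables, and sums over units are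
    built up one unit at a time, so that every step pulls out a power of a single error. A
    conditional statement then becomes an unconditional one, tested against a factor [h] free of the
    errors of period [t].

    Two scalings decide the result. For [N >= 2] the factor [c] satisfies [c^2 * T * N^2 <= 4], so
    the fourth-order error of Stein's method is of order [T * c^4 * N^4 = O(1/T)]. In the remainder
    each period contributes [O(1)] in L^1, and [c * T <= 2 * sqrt T / N].

    With [alpha = E[1 / sigma]], [Omega] is the square of [mu = E[(1 - alpha * sigma)^2]]. It is
    zero when [sigma] is constant; Stein's equation then degenerates, and second moments alone
    settle the limit. *)

Section expectation.
Context {R : realType} {d : measure_display} {Om : measurableType d}.
Variable P : probability Om R.
Implicit Types (X Y : Om -> R) (a b : R).

Definition intg X := P.-integrable setT (EFin \o X).

Lemma intg_meas X : intg X -> measurable_fun setT X.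
Proof. by move=> /integrableP[/measurable_EFinP]. Qed.

Lemma intg_le X Y : measurable_fun setT X -> intg Y ->
  (forall w, `|X w| <= Y w) -> intg X.
Proof.
move=> mX iY XY; apply: (le_integrable measurableT _ _ iY).
  exact/measurable_EFinP.
by move=> w _ /=; rewrite lee_fin (le_trans (XY w) (ler_norm _)).
Qed.

Lemma intg_cst a : intg (fun=> a).
Proof. exact: finite_measure_integrable_cst. Qed.

Lemma intgD X Y : intg X -> intg Y -> intg (fun w => X w + Y w).
Proof. by move=> iX iY; exact: (integrableD measurableT iX iY). Qed.

Lemma intgZ a X : intg X -> intg (fun w => a * X w).
Proof. by move=> iX; exact: (integrableZl measurableT a iX). Qed.

Lemma intgN X : intg X -> intg (fun w => - X w).
Proof.
by move=> /(intgZ (-1)) iX; under [X in intg X]eq_fun do rewrite -mulN1r.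
Qed.

Lemma intgB X Y : intg X -> intg Y -> intg (fun w => X w - Y w).
Proof. by move=> iX iY; apply: intgD => //; exact: intgN. Qed.

Lemma intg_sum (I : Type) (s : seq I) (X : I -> Om -> R) :
  (forall i, intg (X i)) -> intg (fun w => \sum_(i <- s) X i w).
Proof.
move=> iX; elim: s => [|i s IH].
  by under [X in intg X]eq_fun do rewrite big_nil; exact: intg_cst.
by under [X in intg X]eq_fun do rewrite big_cons; exact: intgD.
Qed.

Lemma intg_abs X : intg X -> intg (fun w => `|X w|).
Proof. exact: integrable_abse. Qed.

Lemma intg_bounded X a : measurable_fun setT X -> (forall w, `|X w| <= a) ->
  intg X.
Proof. by move=> mX Xa; exact: (intg_le mX (intg_cst a)). Qed.

Lemma Ex_cst a : Ex P (fun=> a) = a.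
Proof. by rewrite /Ex integral_cst//= probability_setT mule1. Qed.

Lemma ExD X Y : intg X -> intg Y -> Ex P (fun w => X w + Y w) = Ex P X + Ex P Y.
Proof. by move=> iX iY; exact: (RintegralD measurableT iX iY). Qed.

Lemma ExZ a X : intg X -> Ex P (fun w => a * X w) = a * Ex P X.
Proof. by move=> iX; exact: (RintegralZl a measurableT iX). Qed.

Lemma ExB X Y : intg X -> intg Y -> Ex P (fun w => X w - Y w) = Ex P X - Ex P Y.
Proof. by move=> iX iY; exact: (RintegralB measurableT iX iY). Qed.

Lemma Ex_sum (I : Type) (s : seq I) (X : I -> Om -> R) :
  (forall i, intg (X i)) ->
  Ex P (fun w => \sum_(i <- s) X i w) = \sum_(i <- s) Ex P (X i).
Proof.
move=> iX; elim: s => [|i s IH].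
  by rewrite big_nil -[RHS]Ex_cst; congr Ex; apply/funext => w; rewrite big_nil.
rewrite big_cons -IH -ExD//; last exact: intg_sum.
by congr Ex; apply/funext => w; rewrite big_cons.
Qed.

Lemma Ex_le X Y : intg X -> intg Y -> (forall w, X w <= Y w) -> Ex P X <= Ex P Y.
Proof. by move=> iX iY XY; apply: (le_Rintegral measurableT iX iY). Qed.

Lemma Ex_ge0 X : (forall w, 0 <= X w) -> 0 <= Ex P X.
Proof. by move=> X0; apply: Rintegral_ge0. Qed.

Lemma Ex_abs X : intg X -> `|Ex P X| <= Ex P (fun w => `|X w|).
Proof. by move=> iX; exact: (le_normr_Rintegral measurableT iX). Qed.

Lemma Ex_abs_le X Y : measurable_fun setT X -> intg Y ->
  (forall w, `|X w| <= Y w) -> `|Ex P X| <= Ex P Y.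
Proof.
move=> mX iY XY; have iX := intg_le mX iY XY.
apply: le_trans (Ex_abs iX) _; apply: Ex_le => //; exact: intg_abs.
Qed.

Lemma Ex_fin X : intg X -> (\int[P]_w (X w)%:E)%E = (Ex P X)%:E.
Proof. by move=> iX; rewrite fineK//; exact: (integrable_fin_num measurableT). Qed.

Lemma markov_Ex X a : intg X -> (forall w, 0 <= X w) -> 0 < a ->
  (P [set w | (a < X w)%R] <= (Ex P X / a)%:E)%E.
Proof.
move=> iX X0 a0.
have mX := intg_meas iX.
have mS : measurable [set w | (a < X w)%R].
  rewrite -[X in measurable X]setTI.
  rewrite (_ : [set w | (a < X w)%R] = X @^-1` [set` `]a, +oo[%R]).
    by apply: mX => //; exact: measurable_itv.
  by apply/seteqP; split => w /=; rewrite in_itv/= andbT.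
rewrite mulrC EFinM -lee_pdivrMl ?invr_gt0// invrK -Ex_fin//.
rewrite -[X in P X]setIT -(@integral_indic _ _ _ P)// -ge0_integralZl//; first last.
- by rewrite lee_fin ltW.
- exact/measurable_EFinP.
apply: ge0_le_integral => //.
- by move=> w _; rewrite -EFinM lee_fin mulr_ge0// ltW.
- by apply: emeasurable_funM => //; exact/measurable_EFinP/measurable_indic.
- exact/measurable_EFinP.
- move=> w _; rewrite -EFinM lee_fin indicE.
  case: (boolP (w \in _)) => [|_]; last by rewrite mulr0.
  by rewrite inE /= mulr1 => /ltW.
Qed.

(** No norm is attached: the proof needs only closure properties of these classes and explicit
    bounds on moments. *)
Definition Lp (p : nat) X := measurable_fun setT X /\ intg (fun w => `|X w| ^+ p).

Lemma Lp_meas p X : Lp p X -> measurable_fun setT X. Proof. by case. Qed.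

Lemma Lp_bounded p X a : measurable_fun setT X -> (forall w, `|X w| <= a) -> Lp p X.
Proof.
move=> mX Xa; split=> //; apply: (@intg_bounded _ (a ^+ p)).
  by apply: measurable_funX; exact: measurableT_comp.
by move=> w; rewrite normrX normr_id lerXn2r ?nnegrE//; exact: le_trans (Xa w).
Qed.

Lemma Lp_le p q X : (q <= p)%N -> Lp p X -> Lp q X.
Proof.
move=> qp [mX iX]; split=> //.
apply: (@intg_le _ (fun w => 1 + `|X w| ^+ p)).
- by apply: measurable_funX; exact: measurableT_comp.
- by apply: intgD => //; exact: intg_cst.
move=> w; rewrite normrX normr_id; have [X1|X1] := leP `|X w| 1.
  by rewrite (le_trans (exprn_ile1 _ (normr_ge0 _) X1))// lerDl exprn_ge0.
apply: le_trans (_ : _ <= `|X w| ^+ p) _; last by rewrite lerDr.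
by apply: ler_weXn2l => //; exact: ltW.
Qed.

Lemma Lp1_intg X : Lp 1 X -> intg X.
Proof. by move=> [mX iX]; apply: (intg_le mX iX) => w; rewrite expr1. Qed.

Lemma LpX p q X : Lp (p * q) X -> Lp p (fun w => X w ^+ q).
Proof.
move=> [mX iX]; split; first exact: measurable_funX.
by under [X in intg X]eq_fun do rewrite normrX -exprM mulnC.
Qed.

Lemma LpD p X Y : Lp p X -> Lp p Y -> Lp p (fun w => X w + Y w).
Proof.
move=> [mX iX] [mY iY]; split; first exact: measurable_funD.
apply: (@intg_le _ (fun w => 2 ^+ p * (`|X w| ^+ p + `|Y w| ^+ p))).
- by apply: measurable_funX; apply: measurableT_comp => //; exact: measurable_funD.
- by apply: intgZ; exact: intgD.
move=> w; rewrite normrX normr_id.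
wlog YX : X Y {mX mY iX iY} / `|Y w| <= `|X w|.
  move=> H; have [|/ltW] := leP `|Y w| `|X w|; first exact: H.
  by move=> /H; rewrite addrC [X in _ <= _ * X]addrC; apply.
apply: le_trans (_ : (2 * `|X w|) ^+ p <= _).
  apply: lerXn2r; rewrite ?nnegrE ?mulr_ge0//.
  by apply: le_trans (ler_normD _ _) _; rewrite mulr2n mulrDl mul1r lerD2l.
by rewrite exprMn ler_pM2l ?exprn_gt0// lerDl exprn_ge0.
Qed.

(** Pointwise [x * y <= x^2 + y^2] suffices, since only integrability is claimed. This is how eighth
    moments of [eta] make fourth powers of products of two errors integrable. *)
Lemma LpM p X Y : Lp (2 * p) X -> Lp (2 * p) Y -> Lp p (fun w => X w * Y w).
Proof.
move=> [mX iX] [mY iY]; split; first exact: measurable_funM.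
apply: (@intg_le _ (fun w => `|X w| ^+ (2 * p) + `|Y w| ^+ (2 * p))).
- by apply: measurable_funX; apply: measurableT_comp => //; exact: measurable_funM.
- exact: intgD.
move=> w; rewrite normrX normr_id normrM exprMn mulnC !exprM.
set x := _ ^+ p; set y := _ ^+ p.
by have := sqr_ge0 (x - y); have : 0 <= x * y; [rewrite mulr_ge0 ?exprn_ge0|nra].
Qed.

Lemma LpMb p X Y a : measurable_fun setT X -> (forall w, `|X w| <= a) ->
  Lp p Y -> Lp p (fun w => X w * Y w).
Proof.
move=> mX Xa [mY iY]; split; first exact: measurable_funM.
apply: (@intg_le _ (fun w => a ^+ p * `|Y w| ^+ p)).
- by apply: measurable_funX; apply: measurableT_comp => //; exact: measurable_funM.
- exact: intgZ.
move=> w; rewrite normrX normr_id normrM exprMn ler_wpM2r ?exprn_ge0//.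
by apply: lerXn2r; rewrite ?nnegrE//; exact: le_trans (Xa w).
Qed.

Lemma LpZ p a X : Lp p X -> Lp p (fun w => a * X w).
Proof. by move=> LX; apply: (@LpMb p (fun=> a) X `|a|). Qed.

Lemma Lp_sum p (I : Type) (s : seq I) (X : I -> Om -> R) :
  (forall i, Lp p (X i)) -> Lp p (fun w => \sum_(i <- s) X i w).
Proof.
move=> iX; elim: s => [|i s IH].
  under [X in Lp _ X]eq_fun do rewrite big_nil.
  by apply: (@Lp_bounded _ _ 0) => // w; rewrite normr0.
by under [X in Lp _ X]eq_fun do rewrite big_cons; exact: LpD.
Qed.

End expectation.

(** * Products of independent variables *)

Section independence.
Context {R : realType} {d : measure_display} {Om : measurableType d}.
Variable P : probability Om R.

(** By uniqueness of the product measure the joint law is the product of the two marginal laws;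
    Fubini's theorem then yields both integrability and the product formula. *)
Lemma indep_mul (X Y : Om -> R) :
  (forall A B, measurable A -> measurable B ->
    P (X @^-1` A `&` Y @^-1` B) = (P (X @^-1` A) * P (Y @^-1` B))%E) ->
  intg P X -> intg P Y ->
  intg P (fun w => X w * Y w) /\ Ex P (fun w => X w * Y w) = Ex P X * Ex P Y.
Proof.
move=> XY iX iY; have mX := intg_meas iX; have mY := intg_meas iY.
pose X' : {RV P >-> R} := HB.pack X (isMeasurableFun.Build _ _ _ _ _ mX).
pose Y' : {RV P >-> R} := HB.pack Y (isMeasurableFun.Build _ _ _ _ _ mY).
have mZ : measurable_fun setT (fun w => (X w, Y w)) by exact: measurable_fun_pair.
pose Z : {RV P >-> (R * R)%type} :=
  HB.pack (fun w => (X w, Y w)) (isMeasurableFun.Build _ _ _ _ _ mZ).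
pose m := (distribution P X' \x distribution P Y')%E.
have mE S : measurable S -> m S = distribution P Z S.
  by move=> mS; apply: product_measure_unique.
have mf : measurable_fun setT (fun z : R * R => (z.1 * z.2)%:E).
  by apply/measurable_EFinP; apply: measurable_funM.
have idint (V : {RV P >-> R}) : intg P V ->
    (distribution P V).-integrable setT (EFin : R -> \bar R).
  move=> /integrableP[_ iV]; apply/integrableP; split => //.
  rewrite ge0_integral_distribution//.
  by apply: measurableT_comp.
have iX' := idint X' iX; have iY' := idint Y' iY.
have fint : m.-integrable setT (fun z : R * R => (z.1 * z.2)%:E).
  apply/integrable12ltyP => //=.
  have -> : (\int[distribution P X']_x \int[distribution P Y']_y `|(x * y)%:E|
      = \int[distribution P X']_x (`|x%:E| * \int[distribution P Y']_y `|y%:E|))%E.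
    apply: eq_integral => x _; rewrite -ge0_integralZl//.
    by apply: eq_integral => y _; rewrite EFinM abseM.
    exact: measurableT_comp.
  rewrite ge0_integralZr//; last 2 first.
  - exact: measurableT_comp.
  - exact: integral_ge0.
  case/integrableP: iX' => _ ?; case/integrableP: iY' => _ ?.
  by apply: lte_mul_pinfty => //; rewrite ?ge0_fin_numE//; exact: integral_ge0.
have iZ : (distribution P Z).-integrable setT (fun z : R * R => (z.1 * z.2)%:E).
  case/integrableP: fint => _ fint; apply/integrableP; split => //.
  rewrite (eq_measure_integral m)// => S mS _; exact/esym/mE.
have iXY : intg P (fun w => X w * Y w).
  apply/integrableP; split; first by apply/measurable_EFinP; exact: measurable_funM.
  case/integrableP: iZ => _; rewrite ge0_integral_distribution//.
  exact: measurableT_comp.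
split=> //.
have EE (V : {RV P >-> R}) : intg P V ->
    (\int[distribution P V]_x x%:E = (Ex P V)%:E)%E.
  by move=> iV; rewrite integral_distribution ?Ex_fin//.
have : (\int[P]_w (X w * Y w)%:E = (Ex P X)%:E * (Ex P Y)%:E)%E.
  rewrite -(@integral_distribution _ _ _ _ _ _ Z (fun z => (z.1 * z.2)%:E))//.
  rewrite (eq_measure_integral m)//; last first.
    by move=> S mS _; exact/esym/mE.
  rewrite -integral12_prod_meas1// /fubini_F/=.
  rewrite -(EE X')// -integralZr//.
  apply: eq_integral => x _; rewrite -(EE Y')// -integralZl//.
by rewrite Ex_fin// -EFinM => -[].
Qed.

End independence.

(** * Independence of one variable from all the others *)

Section other_variables.
Context {R : realType} {d : measure_display} {Om : measurableType d}.
Variables (P : probability Om R) (I : eqType) (X : I -> Om -> R).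
Hypothesis mX : forall i, measurable_fun setT (X i).
Hypothesis indX : mutually_independent P X.

(** Mutual independence speaks of finite intersections only; these form a pi-system generating the
    sigma-algebra of all variables but [X k]. *)
Definition cyl (k : I) : set (set Om) :=
  [set A | exists s B, [/\ uniq s, k \notin s, forall i, measurable (B i) &
    A = \bigcap_(i in [set` s]) (X i @^-1` B i)]].

(* measurability for the sigma-algebra generated by the [X i] with [i != k] *)
Definition omeas (k : I) (H : Om -> R) :=
  measurable_fun (setT : set (g_sigma_algebraType (cyl k))) (H : g_sigma_algebraType (cyl k) -> R).

Lemma cylI k : setI_closed (cyl k).
Proof.
move=> _ _ [s [B [us ks mB ->]]] [s' [B' [us' ks' mB' ->]]].
exists (undup (s ++ s')).
exists (fun i => (if i \in s then B i else setT) `&` (if i \in s' then B' i else setT)).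
split.
- exact: undup_uniq.
- by rewrite mem_undup mem_cat negb_or ks.
- by move=> i; apply: measurableI; case: ifP.
- apply/seteqP; split => w /=.
    move=> [Bw B'w] i /=; rewrite mem_undup mem_cat => _.
    by split; case: ifP => // ?; [exact: Bw|exact: B'w].
  move=> h; split=> i /= si.
    have /= := h i; rewrite mem_undup mem_cat si/= => /(_ isT)[].
    by [].
  have /= := h i; rewrite mem_undup mem_cat si orbT => /(_ isT)[].
  by [].
Qed.

Lemma cyl_meas k : cyl k `<=` measurable.
Proof.
move=> _ [s [B [us ks mB ->]]].
apply: fin_bigcap_measurable => [|i _]; first exact: finite_seq.
by rewrite -[X in measurable X]setTI; exact: mX.
Qed.

(** Both sides are finite measures in [A] that agree on the pi-system [cyl k], hence on the
    sigma-algebra it generates. *)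
Lemma indep_cyl k B A : measurable B -> <<s cyl k >> A ->
  P (X k @^-1` B `&` A) = (P (X k @^-1` B) * P A)%E.
Proof.
move=> mB sA.
have mXB : measurable (X k @^-1` B) by rewrite -[X in measurable X]setTI; exact: mX.
pose r : {nonneg R} := NngNum (fine_ge0 (measure_ge0 P (X k @^-1` B))).
have rE : (r%:num)%:E = P (X k @^-1` B) by rewrite fineK// fin_num_measure.
rewrite setIC -rE.
apply: (@g_sigma_algebra_measure_unique _ _ _ (cyl k) (@cyl_meas k)
  (fun=> setT) _ _ (mrestr P mXB) (mscale r P) (@cylI k) _ _ A sA).
- move=> _; exists [::], (fun=> setT); split=> //.
  by apply/seteqP; split.
- by apply/seteqP; split => // w _; exists 0%N.
- move=> _ [s [C [us ks mC ->]]].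
  pose D i := if i == k then B else C i.
  have mD i : measurable (D i) by rewrite /D; case: ifP.
  have sD i : i \in s -> D i = C i.
    by move=> si; rewrite /D; case: eqP => // ik; move: ks; rewrite -ik si.
  set A' := \bigcap_(i in _) _.
  change (P (A' `&` X k @^-1` B) = (r%:num)%:E * P A')%E; rewrite rE {}/A'.
  have := @indX (k :: s) D; rewrite /= ks us => /(_ isT mD).
  rewrite big_cons {2}/D eqxx.
  have sE : \bigcap_(i in [set` s]) X i @^-1` C i = \bigcap_(i in [set` s]) X i @^-1` D i.
    by apply: eq_bigcapr => i si; rewrite sD.
  have := @indX s D us mD; rewrite -sE => <- <-; congr (P _).
  apply/seteqP; split => w /= => [[Cw Bw] i|h].
    rewrite /= inE => /predU1P[->|si]; first by rewrite /D eqxx.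
    by rewrite sD//; exact: Cw.
  split; last by have := h k; rewrite /= inE eqxx /D eqxx; apply.
  by move=> i si; have := h i; rewrite /= inE si orbT sD//; apply.
- by move=> _; rewrite -ge0_fin_numE// fin_num_measure.
Qed.

Lemma omeas_meas k H : omeas k H -> measurable_fun setT H.
Proof.
move=> mH _ B mB; have := mH measurableT B mB.
apply: smallest_sub; last exact: cyl_meas.
exact: sigma_algebra_measurable.
Qed.

Lemma omeasX k i : i != k -> omeas k (X i).
Proof.
move=> ik _ B mB; rewrite setTI; apply: sub_sigma_algebra.
exists [:: i], (fun=> B); split=> //; first by rewrite inE eq_sym.
by apply/seteqP; split => w /= => [Bw j|h]; [rewrite /= inE => /eqP ->|apply: (h i); exact: mem_head].
Qed.

(** The form in which independence is used from here on, in place of conditional expectations: a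
    function of one variable is pulled out of an expectation whose other factor is measurable
    without it. *)
Lemma indep_other k (phi : R -> R) H : measurable_fun setT phi ->
  intg P (fun w => phi (X k w)) -> omeas k H -> intg P H ->
  intg P (fun w => phi (X k w) * H w) /\
  Ex P (fun w => phi (X k w) * H w) = Ex P (fun w => phi (X k w)) * Ex P H.
Proof.
move=> mphi iphi oH iH; apply: indep_mul => // A B mA mB.
apply: (@indep_cyl k (phi @^-1` A)).
  by rewrite -[X in measurable X]setTI; exact: mphi.
by have := oH measurableT B mB; rewrite setTI.
Qed.

End other_variables.

(** * Linear and quadratic forms in the errors *)

Section omeas_closure.
Context {R : realType} {d : measure_display} {Om : measurableType d}.
Variables (I : eqType) (X : I -> Om -> R) (k : I).
Implicit Types H K : Om -> R.
Local Notation omeas := (omeas X k).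

Lemma omeas_cst a : omeas (fun=> a).
Proof. exact: measurable_cst. Qed.

Lemma omeasB H K : omeas H -> omeas K -> omeas (fun w => H w - K w).
Proof. by move=> oH oK; exact: measurable_funB. Qed.

Lemma omeasM H K : omeas H -> omeas K -> omeas (fun w => H w * K w).
Proof. by move=> oH oK; exact: measurable_funM. Qed.

Lemma omeasXn H n : omeas H -> omeas (fun w => H w ^+ n).
Proof. by move=> oH; exact: measurable_funX. Qed.

Lemma omeas_comp (f : R -> R) H : measurable_fun setT f -> omeas H ->
  omeas (fun w => f (H w)).
Proof. by move=> mf oH; exact: measurableT_comp. Qed.

Lemma omeas_sum (J : Type) (s : seq J) (H : J -> Om -> R) :
  (forall j, omeas (H j)) -> omeas (fun w => \sum_(j <- s) H j w).
Proof. by move=> oH; exact: measurable_sum. Qed.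

End omeas_closure.

Section panel.
Context {R : realType} {d : measure_display} {Om : measurableType d}.
Variable P : probability Om R.
Variables (sigma : nat -> Om -> R) (eta : nat -> nat -> Om -> R) (K4 : R).

(** Convertible to the family in the independence hypothesis of [theorem1]. *)
Definition vars (k : (nat + (nat * nat))%type) : Om -> R :=
  match k with inl i => sigma i | inr it => eta it.1 it.2 end.

Hypothesis mvars : forall k, measurable_fun setT (vars k).
Hypothesis indvars : mutually_independent P vars.
Hypothesis eta8 : forall i t, Lp P 8 (eta i t).
Hypothesis Eeta : forall i t, Ex P (eta i t) = 0.
Hypothesis Eeta2 : forall i t, Ex P (fun w => eta i t w ^+ 2) = 1.
Hypothesis Eeta4 : forall i t, Ex P (fun w => eta i t w ^+ 4) <= K4.

(** [smeas] stands for being a function of [sigma], [tmeas t] for being free of the errors of period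
    [t]. Both ask only for measurability without each single [eta i t] concerned, which is what
    pulling out one error requires. *)
Definition oth i t := omeas vars (inr (i, t)).
Definition smeas (H : Om -> R) := forall i t, oth i t H.
Definition tmeas t (H : Om -> R) := forall i, oth i t H.

Lemma oth_meas i t H : oth i t H -> measurable_fun setT H.
Proof. exact: omeas_meas. Qed.

Lemma smeas_sigma j : smeas (sigma j).
Proof. by move=> i t; apply: (@omeasX _ _ _ _ vars _ (inl j)). Qed.

Lemma oth_eta i t j s : (j, s) != (i, t) -> oth i t (eta j s).
Proof. by move=> h; apply: (@omeasX _ _ _ _ vars _ (inr (j, s))). Qed.

Lemma Lp_etaX i t n : (n <= 8)%N -> intg P (fun w => eta i t w ^+ n).
Proof.
by move=> n8; apply: Lp1_intg; apply: LpX; rewrite mul1n; exact: Lp_le (eta8 i t).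
Qed.

Lemma Ex_etaX i t H n : (n <= 8)%N -> oth i t H -> intg P H ->
  intg P (fun w => eta i t w ^+ n * H w) /\
  Ex P (fun w => eta i t w ^+ n * H w) = Ex P (fun w => eta i t w ^+ n) * Ex P H.
Proof.
move=> n8 oH iH.
have mphi : measurable_fun setT (fun x : R => x ^+ n) by exact: measurable_funX.
exact: (@indep_other _ _ _ P _ vars mvars indvars (inr (i, t)) _ H mphi (@Lp_etaX i t n n8) oH iH).
Qed.

Lemma intg_eta i t H : oth i t H -> intg P H -> intg P (fun w => eta i t w * H w).
Proof. by move=> oH iH; have [] := @Ex_etaX i t H 1 isT oH iH. Qed.

Lemma Ex_eta i t H : oth i t H -> intg P H -> Ex P (fun w => eta i t w * H w) = 0.
Proof.
move=> oH iH; have [_] := @Ex_etaX i t H 1 isT oH iH.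
by rewrite Eeta mul0r.
Qed.

Lemma Ex_eta2 i t H : oth i t H -> intg P H ->
  Ex P (fun w => eta i t w ^+ 2 * H w) = Ex P H.
Proof. by move=> oH iH; have [_ ->] := @Ex_etaX i t H 2 isT oH iH; rewrite Eeta2 mul1r. Qed.

Lemma Ex_eta4 i t H : oth i t H -> intg P H -> (forall w, 0 <= H w) ->
  Ex P (fun w => eta i t w ^+ 4 * H w) <= K4 * Ex P H.
Proof.
move=> oH iH H0; have [_ ->] := @Ex_etaX i t H 4 isT oH iH.
by rewrite ler_wpM2r ?Eeta4// Ex_ge0.
Qed.

(** * Moments of the linear and quadratic forms *)

Section weights.
Variables (g : nat -> Om -> R) (b : R).
Hypothesis sg : forall i, smeas (g i).
Hypothesis gb : forall i w, `|g i w| <= b.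

(** The weights stay general because these forms serve with [demeaned] weights in the lead term and
    with [sigma] and [isigma] in the remainder. *)
Definition lin n t w := \sum_(i < n) g i w * eta i t w.
Definition quad n t w :=
  \sum_(i < n) \sum_(j < i) (g i w * eta i t w) * (g j w * eta j t w).
(* the conditional variance of [quad n t] given [sigma] *)
Definition qvar n w := \sum_(i < n) \sum_(j < i) g i w ^+ 2 * g j w ^+ 2.

Let b0 : 0 <= b. Proof. exact: le_trans (normr_ge0 _) (gb 0 point). Qed.
Let mg i : measurable_fun setT (g i). Proof. exact: (oth_meas (@sg i 0%N 0%N)). Qed.

Lemma linS n t w : lin n.+1 t w = lin n t w + g n w * eta n t w.
Proof. by rewrite /lin big_ord_recr. Qed.

(** The increment is [eta n t] times a factor free of [eta n t]. All moment computations below are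
    inductions on [n] through this recursion, and no multiple sum is ever expanded. *)
Lemma quadS n t w : quad n.+1 t w = quad n t w + g n w * eta n t w * lin n t w.
Proof. by rewrite /quad big_ord_recr/= mulr_sumr. Qed.

Lemma qvarS n w : qvar n.+1 w = qvar n w + g n w ^+ 2 * \sum_(i < n) g i w ^+ 2.
Proof. by rewrite /qvar big_ord_recr/= mulr_sumr. Qed.

Lemma wX_Lp8 i t : Lp P 8 (fun w => g i w * eta i t w).
Proof. exact: (@LpMb _ _ _ P 8 (g i) (eta i t) b (mg i) (gb i) (eta8 i t)). Qed.

Lemma lin_Lp8 n t : Lp P 8 (lin n t).
Proof. by apply: Lp_sum => i; exact: wX_Lp8. Qed.

Lemma quad_Lp4 n t : Lp P 4 (quad n t).
Proof. by apply: Lp_sum => i; apply: Lp_sum => j; apply: LpM; exact: wX_Lp8. Qed.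

Lemma oth_wX i t j s : (j, s) != (i, t) -> oth i t (fun w => g j w * eta j s w).
Proof. by move=> h; apply: omeasM; [exact: sg|exact: oth_eta]. Qed.

Lemma oth_lin n t : oth n t (lin n t).
Proof.
rewrite /oth /omeas; apply: measurable_sum => j; apply: oth_wX.
by rewrite xpair_eqE negb_and neq_ltn ltn_ord.
Qed.

Lemma oth_quad n t : oth n t (quad n t).
Proof.
apply: omeas_sum => i; apply: omeas_sum => j; apply: omeasM; apply: oth_wX.
  by rewrite xpair_eqE negb_and neq_ltn ltn_ord.
by rewrite xpair_eqE negb_and neq_ltn (ltn_trans (ltn_ord j)).
Qed.

Lemma tmeas_quad n s t : s != t -> tmeas t (quad n s).
Proof.
move=> st k; apply: omeas_sum => i; apply: omeas_sum => j; apply: omeasM; apply: oth_wX;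
by rewrite xpair_eqE negb_and st orbT.
Qed.

Lemma smeas_qvar n : smeas (qvar n).
Proof.
move=> i t; apply: omeas_sum => j; apply: omeas_sum => k; apply: omeasM;
by apply: omeasXn; exact: sg.
Qed.

Lemma sqg_le i w : 0 <= g i w ^+ 2 <= b ^+ 2.
Proof.
by rewrite sqr_ge0/= -real_normK ?num_real// lerXn2r// ?nnegrE.
Qed.

Lemma sum_sqg_le n w : 0 <= \sum_(i < n) g i w ^+ 2 <= b ^+ 2 *+ n.
Proof.
rewrite sumr_ge0/=; last by move=> i _; rewrite sqr_ge0.
rewrite -[X in _ *+ X](card_ord n) -sumr_const; apply: ler_sum => i _.
by have /andP[] := sqg_le i w.
Qed.

Lemma qvar_le n w : 0 <= qvar n w <= b ^+ 4 * n%:R ^+ 2.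
Proof.
elim: n => [|n /andP[IH0 IH]]; first by rewrite /qvar big_ord0 expr0n/= mulr0 lexx.
have /andP[s0 sn] := sum_sqg_le n w; have /andP[q0 qn] := sqg_le n w.
rewrite qvarS (addr_ge0 IH0 (mulr_ge0 q0 s0))/=.
have := ler_pM q0 s0 qn sn; rewrite -mulr_natl => h.
have b4 : 0 <= b ^+ 4 by rewrite exprn_ge0.
have n0 : 0 <= n%:R :> R by [].
apply: le_trans (lerD IH h) _; rewrite -natr1; nra.
Qed.

Lemma qvar_abs n w : `|qvar n w| <= b ^+ 4 * n%:R ^+ 2.
Proof. by have /andP[q0 ?] := qvar_le n w; rewrite ger0_norm. Qed.

Lemma qvar_Lp n p : Lp P p (qvar n).
Proof. apply: Lp_bounded (qvar_abs n); exact: (oth_meas (@smeas_qvar n 0%N 0%N)). Qed.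

(** Every increment has mean zero, since [lin n t] and [h] do not involve [eta n t]. This plays the
    role of a vanishing conditional mean of [Q_t] given the other periods and [sigma]. *)
Lemma Ex_quad_mul n t h : tmeas t h -> Lp P 2 h ->
  Ex P (fun w => quad n t w * h w) = 0.
Proof.
move=> th h2; elim: n => [|n IH].
  by rewrite -[RHS](Ex_cst P); congr Ex; apply/funext => w; rewrite /quad big_ord0 mul0r.
have i1 : intg P (fun w => g n w * (lin n t w * h w)).
  apply: Lp1_intg; apply: LpMb (@gb n) _ => //; apply: LpM => //.
  exact: Lp_le (lin_Lp8 n t).
have o1 : oth n t (fun w => g n w * (lin n t w * h w)).
  by apply: omeasM; [exact: sg|apply: omeasM; [exact: oth_lin|exact: th]].
rewrite -[RHS]addr0 -{1}IH -(Ex_eta o1 i1) -ExD; last 2 first.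
- by apply: Lp1_intg; apply: LpM => //; exact: Lp_le (quad_Lp4 n t).
- exact: intg_eta.
by congr Ex; apply/funext => w; rewrite quadS; ring.
Qed.

(** The cross term vanishes and [eta n t ^+ 2] has mean one. The test factor [h] is what lets the
    next lemma insert its random weight [g n ^+ 2]. *)
Lemma Ex_lin2_mul n t h a : tmeas t h -> (forall w, `|h w| <= a) ->
  Ex P (fun w => lin n t w ^+ 2 * h w) =
  Ex P (fun w => (\sum_(i < n) g i w ^+ 2) * h w).
Proof.
move=> th ha; have mh : measurable_fun setT h := oth_meas (th 0%N).
have hL p Z : Lp P p Z -> Lp P p (fun w => h w * Z w) by apply: LpMb ha.
have gL i p Z : Lp P p Z -> Lp P p (fun w => g i w * Z w) by apply: LpMb (@gb i).
elim: n => [|n IH].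
  by congr Ex; apply/funext => w; rewrite /lin !big_ord0 expr0n.
have i1 : intg P (fun w => 2 * (g n w * (h w * lin n t w))).
  apply: Lp1_intg; apply: LpZ; apply: gL; apply: hL; exact: Lp_le (lin_Lp8 n t).
have o1 : oth n t (fun w => 2 * (g n w * (h w * lin n t w))).
  apply: omeasM; first exact: omeas_cst.
  by apply: omeasM; [exact: sg|apply: omeasM; [exact: th|exact: oth_lin]].
have i2 : intg P (fun w => g n w * (g n w * h w)).
  by apply: Lp1_intg; do 2 apply: (gL n 1%N); apply: Lp_bounded ha.
have o2 : oth n t (fun w => g n w * (g n w * h w)).
  by apply: omeasM; [exact: sg|apply: omeasM; [exact: sg|exact: th]].
have i3 : intg P (fun w => lin n t w ^+ 2 * h w).
  apply: Lp1_intg; under [X in Lp _ _ X]eq_fun do rewrite mulrC; apply: hL; apply: LpX.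
  exact: Lp_le (lin_Lp8 n t).
have i4 : intg P (fun w => (\sum_(i < n) g i w ^+ 2) * h w).
  apply: Lp1_intg; under [X in Lp _ _ X]eq_fun do rewrite mulrC; apply: hL.
  by apply: Lp_sum => i; apply: LpX; apply: Lp_bounded (@gb i).
transitivity (Ex P (fun w => lin n t w ^+ 2 * h w) +
    Ex P (fun w => eta n t w * (2 * (g n w * (h w * lin n t w)))) +
    Ex P (fun w => eta n t w ^+ 2 * (g n w * (g n w * h w)))).
  have [i5 _] := @Ex_etaX n t _ 2 isT o2 i2; have i6 := intg_eta o1 i1.
  rewrite -!ExD//; last exact: intgD.
  by congr Ex; apply/funext => w; rewrite linS; ring.
rewrite (Ex_eta o1 i1) (Ex_eta2 o2 i2) IH addr0 -ExD//.
by congr Ex; apply/funext => w; rewrite big_ord_recr/=; ring.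
Qed.

(** Tested against all such [h], this identifies [qvar n] as the conditional second moment of [Q_t]
    given [sigma] and the other periods. *)
Lemma Ex_quad2_mul n t h a : tmeas t h -> (forall w, `|h w| <= a) ->
  Ex P (fun w => quad n t w ^+ 2 * h w) = Ex P (fun w => qvar n w * h w).
Proof.
move=> th ha; have mh : measurable_fun setT h := oth_meas (th 0%N).
have hL p Z : Lp P p Z -> Lp P p (fun w => h w * Z w) by apply: LpMb ha.
have gL i p Z : Lp P p Z -> Lp P p (fun w => g i w * Z w) by apply: LpMb (@gb i).
elim: n => [|n IH].
  by congr Ex; apply/funext => w; rewrite /quad /qvar !big_ord0 expr0n.
have i1 : intg P (fun w => 2 * (g n w * (h w * (quad n t w * lin n t w)))).
  apply: Lp1_intg; apply: LpZ; apply: gL; apply: hL; apply: LpM.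
    exact: Lp_le (quad_Lp4 n t).
  exact: Lp_le (lin_Lp8 n t).
have o1 : oth n t (fun w => 2 * (g n w * (h w * (quad n t w * lin n t w)))).
  apply: omeasM; first exact: omeas_cst.
  apply: omeasM; [exact: sg|apply: omeasM; [exact: th|]].
  by apply: omeasM; [exact: oth_quad|exact: oth_lin].
have i2 : intg P (fun w => g n w * (g n w * (h w * lin n t w ^+ 2))).
  apply: Lp1_intg; do 2 apply: (gL n 1%N); apply: hL; apply: LpX.
  exact: Lp_le (lin_Lp8 n t).
have o2 : oth n t (fun w => g n w * (g n w * (h w * lin n t w ^+ 2))).
  apply: omeasM; [exact: sg|apply: omeasM; [exact: sg|apply: omeasM; [exact: th|]]].
  by apply: omeasXn; exact: oth_lin.
have i3 : intg P (fun w => quad n t w ^+ 2 * h w).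
  apply: Lp1_intg; under [X in Lp _ _ X]eq_fun do rewrite mulrC; apply: hL; apply: LpX.
  exact: Lp_le (quad_Lp4 n t).
have i4 : intg P (fun w => qvar n w * h w).
  apply: Lp1_intg; under [X in Lp _ _ X]eq_fun do rewrite mulrC; apply: hL.
  exact: qvar_Lp.
have i5 : intg P (fun w => (\sum_(i < n) g i w ^+ 2) * (g n w * (g n w * h w))).
  apply: Lp1_intg; under [X in Lp _ _ X]eq_fun do rewrite mulrC -!mulrA.
  do 2 apply: (gL n 1%N); apply: hL.
  by apply: Lp_sum => i; apply: LpX; apply: Lp_bounded (@gb i).
transitivity (Ex P (fun w => quad n t w ^+ 2 * h w) +
    Ex P (fun w => eta n t w * (2 * (g n w * (h w * (quad n t w * lin n t w))))) +
    Ex P (fun w => eta n t w ^+ 2 * (g n w * (g n w * (h w * lin n t w ^+ 2))))).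
  have [i6 _] := @Ex_etaX n t _ 2 isT o2 i2; have i7 := intg_eta o1 i1.
  rewrite -!ExD//; last exact: intgD.
  by congr Ex; apply/funext => w; rewrite quadS; ring.
(* The weight [g n ^+ 2] is absorbed into the test factor, which remains bounded and free of period
   [t]. *)
have th' : tmeas t (fun w => g n w * (g n w * h w)).
  by move=> i; apply: omeasM; [exact: sg|apply: omeasM; [exact: sg|exact: th]].
have ha' w : `|g n w * (g n w * h w)| <= b * (b * a).
  by rewrite !normrM !ler_pM// ?mulr_ge0.
rewrite (Ex_eta o1 i1) (Ex_eta2 o2 i2) IH addr0.
rewrite [X in _ + X](_ : _ = Ex P (fun w => lin n t w ^+ 2 * (g n w * (g n w * h w)))).
  rewrite (Ex_lin2_mul n th' ha') -ExD//.
  by congr Ex; apply/funext => w; rewrite qvarS; ring.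
by congr Ex; apply/funext => w; ring.
Qed.

Lemma Ex_lin2 n t : Ex P (fun w => lin n t w ^+ 2) <= b ^+ 2 * n%:R.
Proof.
have h1 (w : Om) : `|(1 : R)| <= 1 by rewrite normr1.
have t1 : tmeas t (fun=> 1) by move=> i; exact: omeas_cst.
have := @Ex_lin2_mul n t (fun=> 1) 1 t1 h1.
under [X in Ex _ X]eq_fun do rewrite mulr1; move=> ->.
rewrite -[leRHS](Ex_cst P); apply: Ex_le; last 1 first.
- by move=> w; rewrite mulr1 mulr_natr; have /andP[] := sum_sqg_le n w.
- apply: Lp1_intg; under [X in Lp _ _ X]eq_fun do rewrite mulr1.
  by apply: Lp_sum => i; apply: LpX; apply: Lp_bounded (@gb i).
- exact: intg_cst.
Qed.

Lemma Ex_quad2 n t : Ex P (fun w => quad n t w ^+ 2) = Ex P (qvar n).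
Proof.
have h1 (w : Om) : `|(1 : R)| <= 1 by rewrite normr1.
have t1 : tmeas t (fun=> 1) by move=> i; exact: omeas_cst.
have := @Ex_quad2_mul n t (fun=> 1) 1 t1 h1.
under [X in Ex _ X]eq_fun do rewrite mulr1; move=> ->.
by congr Ex; apply/funext => w; rewrite mulr1.
Qed.

Let K40 : 0 <= K4.
Proof.
apply: le_trans (Eeta4 0 0); apply: Ex_ge0 => w; exact: exprn_even_ge0.
Qed.

Let gX n w : 0 <= g n w ^+ 4 <= b ^+ 4.
Proof.
rewrite exprn_even_ge0//= -[4%N]/(2 * 2)%N !exprM.
by have /andP[q0 ?] := sqg_le n w; rewrite lerXn2r ?nnegrE ?sqr_ge0.
Qed.

(* [linC] and [quadC] are chosen to make the inductions on [n] in the two fourth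
   moment bounds go through *)
Definition linC := 8 * b ^+ 4 + 3 * b ^+ 4 * K4.
Definition quadC := 6 * (K4 * b ^+ 4 * linC).

Lemma linC_ge0 : 0 <= linC.
Proof. by rewrite addr_ge0// !mulr_ge0// exprn_ge0. Qed.

(** With [u = lin n t] and [y] the new summand, [4 u y^3 <= 2 u^2 y^2 + 2 y^4] gives [(u + y)^4 <=
    u^4 + 4 u^3 y + 8 u^2 y^2 + 3 y^4]. No third moment of [eta] remains, and the term linear in [y]
    has mean zero. *)
Lemma Ex_lin4 n t : Ex P (fun w => lin n t w ^+ 4) <= linC * n%:R ^+ 2.
Proof.
have gL i p Z : Lp P p Z -> Lp P p (fun w => g i w * Z w) by apply: LpMb (@gb i).
elim: n => [|n IH].
  rewrite expr0n mulr0 -[leRHS](Ex_cst P); apply/eqP/eqP; rewrite le_eqVlt.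
  by apply/orP; left; apply/eqP; congr Ex; apply/funext => w; rewrite /lin big_ord0 expr0n.
have i1 : intg P (fun w => 4 * (g n w * lin n t w ^+ 3)).
  apply: Lp1_intg; apply: LpZ; apply: gL; apply: LpX; exact: Lp_le (lin_Lp8 n t).
have o1 : oth n t (fun w => 4 * (g n w * lin n t w ^+ 3)).
  apply: omeasM; first exact: omeas_cst.
  by apply: omeasM; [exact: sg|apply: omeasXn; exact: oth_lin].
have i2 : intg P (fun w => 8 * (g n w * (g n w * lin n t w ^+ 2))).
  apply: Lp1_intg; apply: LpZ; do 2 apply: (gL n 1%N); apply: LpX.
  exact: Lp_le (lin_Lp8 n t).
have o2 : oth n t (fun w => 8 * (g n w * (g n w * lin n t w ^+ 2))).
  apply: omeasM; first exact: omeas_cst.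
  by apply: omeasM; [exact: sg|apply: omeasM; [exact: sg|apply: omeasXn; exact: oth_lin]].
have i3 : intg P (fun w => 3 * g n w ^+ 4).
  by apply: Lp1_intg; apply: LpZ; apply: LpX; apply: Lp_bounded (@gb n).
have o3 : oth n t (fun w => 3 * g n w ^+ 4).
  by apply: omeasM; [exact: omeas_cst|apply: omeasXn; exact: sg].
have iL m : intg P (fun w => lin m t w ^+ 4).
  by apply: Lp1_intg; apply: LpX; exact: Lp_le (lin_Lp8 m t).
have iL2 : intg P (fun w => lin n t w ^+ 2).
  by apply: Lp1_intg; apply: LpX; exact: Lp_le (lin_Lp8 n t).
have j1 := intg_eta o1 i1.
have [j2 _] := @Ex_etaX n t _ 2 isT o2 i2.
have [j3 _] := @Ex_etaX n t _ 4 isT o3 i3.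
apply: le_trans (_ : Ex P (fun w => lin n t w ^+ 4) +
    Ex P (fun w => eta n t w * (4 * (g n w * lin n t w ^+ 3))) +
    Ex P (fun w => eta n t w ^+ 2 * (8 * (g n w * (g n w * lin n t w ^+ 2)))) +
    Ex P (fun w => eta n t w ^+ 4 * (3 * g n w ^+ 4)) <= _).
  rewrite -!ExD//; try by do ?apply: intgD.
  apply: Ex_le => //; first by do ?apply: intgD.
  move=> w; rewrite linS; set u := lin n t w; set x := g n w; set e := eta n t w.
  by have := sqr_ge0 ((x * e) * (u - x * e)); rewrite -subr_ge0; nra.
rewrite (Ex_eta o1 i1) addr0 (Ex_eta2 o2 i2).
have h3 : Ex P (fun w => eta n t w ^+ 4 * (3 * g n w ^+ 4)) <= K4 * (3 * b ^+ 4).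
  apply: le_trans (Ex_eta4 o3 i3 _) _.
    by move=> w; have /andP[? _] := gX n w; rewrite mulr_ge0.
  rewrite ler_wpM2l// -[leRHS](Ex_cst P); apply: Ex_le => //; first exact: intg_cst.
  by move=> w; have /andP[_ ?] := gX n w; rewrite ler_wpM2l.
have h2 : Ex P (fun w => 8 * (g n w * (g n w * lin n t w ^+ 2))) <= 8 * b ^+ 4 * n%:R.
  apply: le_trans (_ : Ex P (fun w => (8 * b ^+ 2) * lin n t w ^+ 2) <= _).
    apply: Ex_le => //; first exact: intgZ.
    move=> w; have /andP[_ ?] := sqg_le n w.
    rewrite (_ : 8 * _ = 8 * g n w ^+ 2 * lin n t w ^+ 2); last by ring.
    by rewrite ler_wpM2r ?sqr_ge0// ler_wpM2l.
  rewrite ExZ//; apply: le_trans (ler_wpM2l _ (Ex_lin2 n t)) _.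
    by rewrite mulr_ge0// sqr_ge0.
  by rewrite le_eqVlt; apply/orP; left; apply/eqP; ring.
have := lerD (lerD IH h2) h3; move=> h; apply: le_trans h _.
have b4 : 0 <= b ^+ 4 by rewrite exprn_ge0.
have b4K : 0 <= b ^+ 4 * K4 by rewrite mulr_ge0.
have n0 : 0 <= n%:R :> R by [].
rewrite /linC -natr1; nra.
Qed.

(** The mixed moment of [quad ^+ 2] and [lin ^+ 2] is avoided by splitting it into fourth powers
    with a weight depending on [n]. *)
Lemma Ex_quad4 n t : Ex P (fun w => quad n t w ^+ 4) <= quadC * n%:R ^+ 4.
Proof.
have gL i p Z : Lp P p Z -> Lp P p (fun w => g i w * Z w) by apply: LpMb (@gb i).
elim: n => [|n IH].
  rewrite expr0n mulr0 -[leRHS](Ex_cst P) le_eqVlt.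
  by apply/orP; left; apply/eqP; congr Ex; apply/funext => w; rewrite /quad big_ord0 expr0n.
have i1 : intg P (fun w => 4 * (g n w * (lin n t w * quad n t w ^+ 3))).
  apply: Lp1_intg; apply: LpZ; apply: gL.
  under [X in Lp _ _ X]eq_fun do rewrite exprS mulrA.
  apply: LpM; last by apply: LpX; exact: quad_Lp4.
  by apply: LpM; [exact: Lp_le (lin_Lp8 n t)|exact: quad_Lp4].
have o1 : oth n t (fun w => 4 * (g n w * (lin n t w * quad n t w ^+ 3))).
  apply: omeasM; first exact: omeas_cst.
  apply: omeasM; [exact: sg|apply: omeasM; [exact: oth_lin|]].
  by apply: omeasXn; exact: oth_quad.
have iL : intg P (fun w => lin n t w ^+ 4).
  by apply: Lp1_intg; apply: LpX; exact: Lp_le (lin_Lp8 n t).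
(* With this weight the factor [1 + 1/m] raises a bound of order [n^4] by [O(n^3)] only, and [m]
   times the [O(n^2)] fourth moment of [lin] is [O(n^3)] as well: both fit in the increment of
   [n^4]. *)
pose m : R := n.+1%:R; have m0 : 0 < m by [].
pose c := 16 * m + 3; have c0 : 0 <= c by rewrite addr_ge0// mulr_ge0// ltW.
have i3 : intg P (fun w => c * (g n w ^+ 4 * lin n t w ^+ 4)).
  apply: intgZ; apply: (@intg_le _ _ _ P _ (fun w => b ^+ 4 * lin n t w ^+ 4)).
  - apply: measurable_funM; apply: measurable_funX => //.
    exact: Lp_meas (lin_Lp8 n t).
  - exact: intgZ.
  - move=> w; have /andP[q0 qn] := gX n w.
    rewrite ger0_norm; last by rewrite mulr_ge0// exprn_even_ge0.
    by rewrite ler_wpM2r// exprn_even_ge0.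
have o3 : oth n t (fun w => c * (g n w ^+ 4 * lin n t w ^+ 4)).
  apply: omeasM; [exact: omeas_cst|apply: omeasM; apply: omeasXn; first exact: sg].
  exact: oth_lin.
have iQ k : intg P (fun w => quad k t w ^+ 4).
  by apply: Lp1_intg; apply: LpX; exact: quad_Lp4.
have j1 := intg_eta o1 i1.
have [j3 _] := @Ex_etaX n t _ 4 isT o3 i3.
apply: le_trans (_ : Ex P (fun w => (1 + m^-1) * quad n t w ^+ 4) +
    Ex P (fun w => eta n t w * (4 * (g n w * (lin n t w * quad n t w ^+ 3)))) +
    Ex P (fun w => eta n t w ^+ 4 * (c * (g n w ^+ 4 * lin n t w ^+ 4))) <= _).
  have j0 := intgZ (1 + m^-1) (iQ n).
  rewrite -!ExD//; try by do ?apply: intgD.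
  apply: Ex_le => //; first by do ?apply: intgD.
  move=> w; rewrite quadS; set q := quad n t w; set x := g n w.
  set e := eta n t w; set u := lin n t w.
  set y := x * e * u.
  have -> : e * (4 * (x * (u * q ^+ 3))) = 4 * q ^+ 3 * y by rewrite /y; ring.
  have -> : e ^+ 4 * (c * (x ^+ 4 * u ^+ 4)) = c * y ^+ 4 by rewrite /y; ring.
  (* weighted AM-GM : [8 q^2 y^2 <= q^4 / m + 16 m y^4] *)
  have h1 : 0 <= m^-1 * (q ^+ 2 - 4 * m * y ^+ 2) ^+ 2.
    by rewrite mulr_ge0 ?sqr_ge0// invr_ge0 ltW.
  have h2 : m^-1 * (q ^+ 2 - 4 * m * y ^+ 2) ^+ 2 =
      m^-1 * q ^+ 4 - 8 * q ^+ 2 * y ^+ 2 + 16 * m * y ^+ 4.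
    by field; rewrite gt_eqF.
  rewrite h2 in h1.
  rewrite -subr_ge0 (_ : _ - _ = (m^-1 * q ^+ 4 - 8 * q ^+ 2 * y ^+ 2 + 16 * m * y ^+ 4)
    + 2 * (y * (q - y)) ^+ 2); last by rewrite /c; ring.
  by rewrite addr_ge0// mulr_ge0// sqr_ge0.
rewrite (Ex_eta o1 i1) addr0 ExZ//.
have h3 : Ex P (fun w => eta n t w ^+ 4 * (c * (g n w ^+ 4 * lin n t w ^+ 4)))
    <= K4 * (c * (b ^+ 4 * (linC * n%:R ^+ 2))).
  apply: le_trans (Ex_eta4 o3 i3 _) _.
    by move=> w; rewrite mulr_ge0// mulr_ge0 ?exprn_even_ge0.
  rewrite ler_wpM2l//; apply: le_trans (_ : Ex P (fun w => c * b ^+ 4 * lin n t w ^+ 4) <= _).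
    apply: Ex_le => //; first exact: intgZ.
    move=> w; have /andP[_ ?] := gX n w.
    by rewrite -mulrA ler_wpM2l// ler_wpM2r// exprn_even_ge0.
  rewrite ExZ// -mulrA; do 2 (apply: ler_wpM2l; rewrite ?exprn_ge0//).
  exact: Ex_lin4.
have hm : 0 <= 1 + m^-1 by rewrite addr_ge0// invr_ge0 ltW.
apply: le_trans (lerD (ler_wpM2l hm IH) h3) _.
have n0 : 0 <= n%:R :> R by [].
have mE : m = n%:R + 1 by rewrite natr1.
have hn : m^-1 * n%:R ^+ 4 <= n%:R ^+ 3.
  rewrite mulrC ler_pdivrMr// exprSr ler_wpM2l ?exprn_ge0// mE; lra.
rewrite /quadC; set D := K4 * b ^+ 4 * linC.
have D0 : 0 <= D by rewrite /D !mulr_ge0 ?exprn_ge0// linC_ge0.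
have -> : K4 * (c * (b ^+ 4 * (linC * n%:R ^+ 2))) = D * (c * n%:R ^+ 2).
  by rewrite /D; ring.
have -> : (1 + m^-1) * (6 * D * n%:R ^+ 4) = 6 * D * (n%:R ^+ 4 + m^-1 * n%:R ^+ 4) by ring.
have h4 : 6 * D * (n%:R ^+ 4 + m^-1 * n%:R ^+ 4) <= 6 * D * (n%:R ^+ 4 + n%:R ^+ 3).
  by apply: ler_wpM2l; rewrite ?lerD2l// mulr_ge0.
apply: le_trans (lerD h4 (lexx _)) _.
(* If [quadC] is [k * D], comparing the coefficients of [z^3] requires [4 k >= k + 16]; [k = 6] is
   the least such integer. *)
rewrite -/m /c mE; set z : R := n%:R.
have -> : 6 * D * (z ^+ 4 + z ^+ 3) + D * ((16 * (z + 1) + 3) * z ^+ 2) =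
  D * (6 * z ^+ 4 + 22 * z ^+ 3 + 19 * z ^+ 2) by ring.
have -> : 6 * D * (z + 1) ^+ 4 = D * (6 * (z + 1) ^+ 4) by ring.
apply: ler_wpM2l => //.
have z3 : 0 <= z ^+ 3 by rewrite exprn_ge0.
have z2 : 0 <= z ^+ 2 by rewrite exprn_ge0.
have z1 : 0 <= z by [].
rewrite -subr_ge0; have -> : 6 * (z + 1) ^+ 4 - (6 * z ^+ 4 + 22 * z ^+ 3 + 19 * z ^+ 2)
  = 2 * z ^+ 3 + 17 * z ^+ 2 + 24 * z + 6 by ring.
lra.
Qed.

Lemma Ex_qvar_le n : Ex P (qvar n) <= b ^+ 4 * n%:R ^+ 2.
Proof.
rewrite -[leRHS](Ex_cst P); apply: Ex_le.
- exact: Lp1_intg (qvar_Lp _ _).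
- exact: intg_cst.
- by move=> w; have /andP[] := qvar_le n w.
Qed.

Definition wsum n c T w := c * \sum_(t < T) quad n t w.

Lemma wsum_Lp4 n c T : Lp P 4 (wsum n c T).
Proof. by apply: LpZ; apply: Lp_sum => t; exact: quad_Lp4. Qed.

(** The sum over earlier periods is free of the errors of the new period, so the cross term vanishes
    by [Ex_quad_mul]. *)
Lemma Ex_wsum2 n c T :
  Ex P (fun w => wsum n c T w ^+ 2) = c ^+ 2 * T%:R * Ex P (qvar n).
Proof.
elim: T => [|T IH].
  rewrite mulr0 mul0r -[RHS](Ex_cst P); congr Ex; apply/funext => w.
  by rewrite /wsum big_ord0 mulr0 expr0n.
have tW : tmeas T (fun w => 2 * c * wsum n c T w).
  move=> i; apply: omeasM; first exact: omeas_cst.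
  apply: omeasM; first exact: omeas_cst.
  apply: omeas_sum => t; apply: tmeas_quad.
  by rewrite neq_ltn ltn_ord.
have W2 : Lp P 2 (fun w => 2 * c * wsum n c T w).
  by apply: LpZ; exact: Lp_le (wsum_Lp4 n c T).
have i1 : intg P (fun w => quad n T w * (2 * c * wsum n c T w)).
  by apply: Lp1_intg; apply: LpM => //; exact: Lp_le (quad_Lp4 n T).
have i2 : intg P (fun w => wsum n c T w ^+ 2).
  by apply: Lp1_intg; apply: LpX; exact: Lp_le (wsum_Lp4 n c T).
have i3 : intg P (fun w => quad n T w ^+ 2).
  by apply: Lp1_intg; apply: LpX; exact: Lp_le (quad_Lp4 n T).
transitivity (Ex P (fun w => wsum n c T w ^+ 2) +
    Ex P (fun w => quad n T w * (2 * c * wsum n c T w)) +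
    Ex P (fun w => c ^+ 2 * quad n T w ^+ 2)).
  have i4 := intgZ (c ^+ 2) i3.
  rewrite -!ExD//; last exact: intgD.
  congr Ex; apply/funext => w.
  by rewrite {1}/wsum big_ord_recr/= mulrDr -/(wsum n c T w); ring.
by rewrite Ex_quad_mul// ExZ// Ex_quad2 IH -natr1; ring.
Qed.

(** * Stein's method, leaving out one period at a time *)

Section stein.
Variables (n T : nat) (c : R) (f f' : R -> R) (a e C : R).
Hypothesis mf : measurable_fun setT f.
Hypothesis mf' : measurable_fun setT f'.
Hypothesis fa : forall x, `|f x| <= a.
Hypothesis f'a : forall x, `|f' x| <= a.
Hypotheses (e0 : 0 <= e) (C0 : 0 <= C).
(** A bound [e + C y^2] is available for any continuous compactly supported [f'], with [e] as small
    as desired. At [y = c * Q_t] it produces only second and fourth moments of [Q_t]. *)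
Hypothesis ff' : forall x y, `|f (x + y) - f x - y * f' x| <= `|y| * (e + C * y ^+ 2).
Hypothesis f'U : forall x y, `|f' (x + y) - f' x| <= e + C * y ^+ 2.

Let W := wsum n c T.
Let mW : measurable_fun setT W. Proof. exact: Lp_meas (wsum_Lp4 n c T). Qed.
Let fL p (u : R -> R) (Y Z : Om -> R) : measurable_fun setT u ->
  (forall x, `|u x| <= a) -> measurable_fun setT Y ->
  Lp P p Z -> Lp P p (fun w => u (Y w) * Z w).
Proof. by move=> mu ua mY; apply: LpMb (fun w => ua (Y w)); exact: measurableT_comp. Qed.

(** Expand [f] around [Wt], the sum without period [t]: the zeroth-order term vanishes by
    [Ex_quad_mul], and the first-order term becomes [qvar] times [f'] by [Ex_quad2_mul]. *)
Lemma stein_step (t : 'I_T) :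
  `|Ex P (fun w => c * quad n t w * f (W w)) -
    Ex P (fun w => c ^+ 2 * qvar n w * f' (W w))| <=
  2 * e * c ^+ 2 * (b ^+ 4 * n%:R ^+ 2) + C * c ^+ 4 * ((quadC + b ^+ 8) * n%:R ^+ 4).
Proof.
pose Wt w := c * \sum_(s < T) (if s != t then quad n s w else 0).
have WE w : W w = Wt w + c * quad n t w.
  rewrite /W /Wt /wsum -mulrDr (bigD1 t)//= addrC big_mkcond/=.
  by congr (c * (_ + _)); apply: eq_bigr.
have tWt : tmeas t Wt.
  move=> i; apply: omeasM; first exact: omeas_cst.
  apply: omeas_sum => s; have [st|_] := boolP (s != t); last exact: omeas_cst.
  by apply: tmeas_quad; apply: contraNneq st => /val_inj ->.
have mWt : measurable_fun setT Wt := oth_meas (tWt 0%N).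
have t0 : tmeas t (fun w => f (Wt w)) by move=> i; apply: omeas_comp => //; exact: tWt.
have t1 : tmeas t (fun w => f' (Wt w)) by move=> i; apply: omeas_comp => //; exact: tWt.
have h02 : Lp P 2 (fun w => f (Wt w)).
  by apply: (@Lp_bounded _ _ _ P _ _ a) => //; exact: measurableT_comp.
have Q4 := quad_Lp4 n t.
have Q2 : Lp P 2 (fun w => quad n t w ^+ 2) by exact: LpX.
pose q w := quad n t w.
have iQ2 : intg P (fun w => q w ^+ 2) by apply: Lp1_intg; exact: Lp_le Q2.
have iQ4 : intg P (fun w => q w ^+ 4) by apply: Lp1_intg; exact: LpX.
have i1 : intg P (fun w => c * q w * f (W w)).
  under [X in intg _ X]eq_fun do rewrite mulrC.
  by apply: Lp1_intg; apply: fL => //; apply: LpZ; exact: Lp_le Q4.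
have i2 : intg P (fun w => c * (q w * f (Wt w))).
  apply: intgZ; under [X in intg _ X]eq_fun do rewrite mulrC.
  by apply: Lp1_intg; apply: fL => //; exact: Lp_le Q4.
have i3 : intg P (fun w => c ^+ 2 * (q w ^+ 2 * f' (Wt w))).
  apply: intgZ; under [X in intg _ X]eq_fun do rewrite mulrC.
  by apply: Lp1_intg; apply: fL => //; exact: Lp_le Q2.
have i4 : intg P (fun w => c ^+ 2 * (qvar n w * f' (Wt w))).
  apply: intgZ; under [X in intg _ X]eq_fun do rewrite mulrC.
  by apply: Lp1_intg; apply: fL => //; exact: qvar_Lp.
have i5 : intg P (fun w => c ^+ 2 * qvar n w * f' (W w)).
  under [X in intg _ X]eq_fun do rewrite mulrC.
  by apply: Lp1_intg; apply: fL => //; apply: LpZ; exact: qvar_Lp.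
pose B := b ^+ 4 * n%:R ^+ 2.
have B0 : 0 <= B by rewrite mulr_ge0// exprn_ge0.
have EQ2 : Ex P (fun w => q w ^+ 2) <= B.
  by rewrite /q Ex_quad2; exact: Ex_qvar_le.
(* [r1] is [c * q] times the Taylor remainder of [f] at [Wt]; [r2] is the cost of returning from
   [Wt] to [W] inside [f']. *)
pose r1 w := c * q w * f (W w) - c * (q w * f (Wt w)) - c ^+ 2 * (q w ^+ 2 * f' (Wt w)).
pose r2 w := c ^+ 2 * (qvar n w * f' (Wt w)) - c ^+ 2 * qvar n w * f' (W w).
have ir1 : intg P r1 by do 2 apply: intgB => //.
have ir2 : intg P r2 by apply: intgB.
have r1E : Ex P (fun w => c * q w * f (W w)) =
    Ex P r1 + Ex P (fun w => c ^+ 2 * (qvar n w * f' (Wt w))).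
  rewrite /r1 ExB//; last exact: intgB.
  rewrite ExB// ExZ; last first.
    under [X in intg _ X]eq_fun do rewrite mulrC.
    by apply: Lp1_intg; apply: fL => //; exact: Lp_le Q4.
  rewrite Ex_quad_mul// ExZ; last first.
    under [X in intg _ X]eq_fun do rewrite mulrC.
    by apply: Lp1_intg; apply: fL => //; exact: Lp_le Q2.
  rewrite (Ex_quad2_mul n t1 (fun w => f'a (Wt w))) ExZ; first by ring.
  under [X in intg _ X]eq_fun do rewrite mulrC.
  by apply: Lp1_intg; apply: fL => //; exact: qvar_Lp.
have r2E : Ex P r2 = Ex P (fun w => c ^+ 2 * (qvar n w * f' (Wt w))) -
    Ex P (fun w => c ^+ 2 * qvar n w * f' (W w)) by rewrite /r2 ExB.
have -> : Ex P (fun w => c * q w * f (W w)) - Ex P (fun w => c ^+ 2 * qvar n w * f' (W w))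
    = Ex P r1 + Ex P r2 by rewrite r1E r2E; ring.
have b1 : `|Ex P r1| <= e * c ^+ 2 * B + C * c ^+ 4 * (quadC * n%:R ^+ 4).
  apply: le_trans (_ : Ex P (fun w => e * c ^+ 2 * q w ^+ 2 + C * c ^+ 4 * q w ^+ 4) <= _).
    apply: Ex_abs_le; first exact: intg_meas ir1.
      by apply: intgD; apply: intgZ.
    move=> w; rewrite (_ : r1 w = (c * q w) * (f (Wt w + c * q w) - f (Wt w) - (c * q w) * f' (Wt w))).
      rewrite normrM; apply: le_trans (ler_wpM2l (normr_ge0 _) (ff' _ _)) _.
      rewrite mulrA -expr2 real_normK ?num_real// le_eqVlt; apply/orP; left; apply/eqP.
      by ring.
    by rewrite /r1 WE; ring.
  rewrite ExD; [|by apply: intgZ..].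
  rewrite !ExZ//; apply: lerD.
    by apply: ler_wpM2l => //; rewrite mulr_ge0// sqr_ge0.
  by apply: ler_wpM2l; [rewrite mulr_ge0// exprn_even_ge0|exact: Ex_quad4].
have b2 : `|Ex P r2| <= e * c ^+ 2 * B + C * c ^+ 4 * (b ^+ 8 * n%:R ^+ 4).
  apply: le_trans (_ : Ex P (fun w => e * c ^+ 2 * B + C * c ^+ 4 * B * q w ^+ 2) <= _).
    apply: Ex_abs_le; first exact: intg_meas ir2.
      by apply: intgD; [exact: intg_cst|exact: intgZ].
    move=> w; rewrite (_ : r2 w = - (c ^+ 2 * qvar n w * (f' (Wt w + c * q w) - f' (Wt w)))).
      rewrite normrN normrM.
      apply: le_trans (_ : c ^+ 2 * B * (e + C * (c * q w) ^+ 2) <= _).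
        apply: ler_pM => //.
        rewrite normrM ger0_norm ?sqr_ge0// ler_wpM2l ?sqr_ge0//.
        exact: qvar_abs.
      by rewrite le_eqVlt; apply/orP; left; apply/eqP; ring.
    by rewrite /r2 WE; ring.
  rewrite ExD; [|exact: intg_cst|exact: intgZ].
  rewrite Ex_cst ExZ// lerD2l.
  have -> : C * c ^+ 4 * (b ^+ 8 * n%:R ^+ 4) = C * c ^+ 4 * B * B by rewrite /B; ring.
  apply: ler_wpM2l => //; apply: mulr_ge0 => //; apply: mulr_ge0 => //.
  exact: exprn_even_ge0.
apply: le_trans (ler_normD _ _) _.
apply: le_trans (lerD b1 b2) _; rewrite -/B.
by rewrite le_eqVlt; apply/orP; left; apply/eqP; ring.
Qed.

Lemma stein_bound :
  `|Ex P (fun w => W w * f (W w)) -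
    Ex P (fun w => c ^+ 2 * T%:R * qvar n w * f' (W w))| <=
  T%:R * (2 * e * c ^+ 2 * (b ^+ 4 * n%:R ^+ 2)
          + C * c ^+ 4 * ((quadC + b ^+ 8) * n%:R ^+ 4)).
Proof.
have i1 t : intg P (fun w => c * quad n t w * f (W w)).
  under [X in intg _ X]eq_fun do rewrite mulrC.
  by apply: Lp1_intg; apply: fL => //; apply: LpZ; exact: Lp_le (quad_Lp4 n t).
have i5 : intg P (fun w => c ^+ 2 * qvar n w * f' (W w)).
  under [X in intg _ X]eq_fun do rewrite mulrC.
  by apply: Lp1_intg; apply: fL => //; apply: LpZ; exact: qvar_Lp.
have -> : Ex P (fun w => W w * f (W w)) =
    \sum_(t < T) Ex P (fun w => c * quad n t w * f (W w)).
  rewrite -Ex_sum//; congr Ex; apply/funext => w.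
  by rewrite -mulr_suml -mulr_sumr.
have -> : Ex P (fun w => c ^+ 2 * T%:R * qvar n w * f' (W w)) =
    \sum_(t < T) Ex P (fun w => c ^+ 2 * qvar n w * f' (W w)).
  rewrite sumr_const card_ord -[RHS]mulr_natl -ExZ//; congr Ex; apply/funext => w.
  by ring.
rewrite -sumrB [leRHS]mulr_natl -[X in _ *+ X](card_ord T) -sumr_const.
apply: le_trans (ler_norm_sum _ _ _) _.
by apply: ler_sum => t _; exact: stein_step.
Qed.

End stein.

End weights.
End panel.

(** * Compactly supported functions *)

Section compactly_supported.
Context {R : realType}.
Implicit Types (u : R -> R) (A e : R).

Lemma csupp_bounded u A : continuous u -> (forall x, A <= `|x| -> u x = 0) ->
  exists2 B, 0 <= B & forall x, `|u x| <= B.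
Proof.
move=> cu uA; pose A' := Num.max A 0.
have A'00 : 0 <= A' by rewrite le_max lexx orbT.
have A'0 : - A' <= A' by rewrite (le_trans _ A'00)// oppr_le0.
have cv : {within `[- A', A'], continuous (fun x => `|u x|)}.
  apply: continuous_subspaceT => x; apply: continuous_comp; first exact: cu.
  exact: norm_continuous.
have [c _ hc] := EVT_max A'0 cv.
exists `|u c| => // x; have [xA|xA] := leP A' `|x|.
  by rewrite uA ?normr0// (le_trans _ xA)// le_max lexx.
by apply: hc; rewrite in_itv/= -ler_norml ltW.
Qed.

Lemma csupp_unif u A e : continuous u -> (forall x, A <= `|x| -> u x = 0) ->
  0 < e -> exists2 D, 0 < D & forall x y, `|y| < D -> `|u (x + y) - u x| <= e.
Proof.
(* The margin 1 ensures that for [|x| > A'] and [|y| < D < 1] both [x] and [x + y] lie where [u]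
   vanishes. *)
move=> cu uA e0; pose A' := Num.max A 0 + 1.
have : near_covering `[- A', A'] by apply/compact_near_coveringP; exact: segment_compact.
pose Q (D x : R) := forall y, `|y| < D -> `|u (x + y) - u x| <= e.
move=> /(_ R (0:R)^'+ Q _).
have hQ x : `[- A', A']%classic x -> \forall x' \near x & D \near (0:R)^'+, Q D x'.
  move=> _.
  have /cvgrPdist_lt/(_ (e / 2)) := cu x.
  rewrite divr_gt0// => /(_ isT) /nbhs_ballP[r /= r0 hr].
  have r2 : 0 < r / 2 by rewrite divr_gt0.
  exists (ball x (r / 2), [set D | 0 < D < r / 2]) => /=.
    split; first exact: nbhsx_ballx.
    near=> D; apply/andP; split; near: D.
      exact: nbhs_right_gt.
    exact: nbhs_right_lt.
  move=> [z D]/= [xz /andP[D0 Dr]] y yD.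
  move: xz; rewrite /ball/= => xz.
  have h1 : `|u x - u z| < e / 2.
    by apply: hr; rewrite /ball/=; lra.
  have h2 : `|u x - u (z + y)| < e / 2.
    apply: hr; rewrite /ball/= opprD addrA (le_lt_trans (ler_normB _ _))//; lra.
  rewrite distrC; have -> : u z - u (z + y) = (u x - u (z + y)) - (u x - u z) by ring.
  apply: le_trans (ler_normB _ _) _; lra.
move=> /(_ hQ) /= hN.
have : \forall D \near (0:R)^'+, 0 < D < 1 /\ `[- A', A']%classic `<=` Q D.
  near=> D; split; last by near: D.
  apply/andP; split; near: D; [exact: nbhs_right_gt|exact: nbhs_right_lt].
move=> /filter_ex[D [/andP[D0 D1] hD]]; exists D => // x y yD.
have A'1 : A + 1 <= A' by rewrite lerD2r le_max lexx.
have [xA|xA] := leP `|x| A'.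
  by apply: hD => //=; rewrite in_itv/= -ler_norml.
rewrite uA ?uA ?subrr ?normr0 ?(ltW e0)//; first lra.
have := lerB_normD x y; lra.
Unshelve. all: by end_near. Qed.

(** Increments below the threshold of uniform continuity contribute at most [e]; beyond it the total
    oscillation [2 * B] is absorbed by [|y| / D] or [(y / D)^2]. The linear bound serves to compare
    two variables close in L^1, the quadratic one serves Stein's method. *)
Lemma csupp_modulus u A e : continuous u -> (forall x, A <= `|x| -> u x = 0) ->
  0 < e -> exists2 C, 0 <= C &
    forall x y, `|u (x + y) - u x| <= e + C * `|y| /\
                `|u (x + y) - u x| <= e + C * y ^+ 2.
Proof.
move=> cu uA e0; have [B B0 uB] := csupp_bounded cu uA.
have [D D0 uD] := csupp_unif cu uA e0.
have C10 : 0 <= 2 * B / D by rewrite divr_ge0 ?mulr_ge0// ltW.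
have C20 : 0 <= 2 * B / D ^+ 2 by rewrite divr_ge0 ?sqr_ge0// mulr_ge0.
exists (2 * B / D + 2 * B / D ^+ 2) => [|x y]; first by rewrite addr_ge0.
have [yD|Dy] := ltP `|y| D.
  have h := uD x y yD; split; apply: le_trans h _; rewrite lerDl mulr_ge0 ?addr_ge0//.
  exact: sqr_ge0.
have h : `|u (x + y) - u x| <= 2 * B.
  by apply: le_trans (ler_normB _ _) _; have := uB (x + y); have := uB x; lra.
split; apply: le_trans h _.
  apply: le_trans (_ : 2 * B / D * `|y| <= _).
    by rewrite mulrAC ler_pdivlMr// ler_wpM2l// mulr_ge0.
  by rewrite mulrDl; have := mulr_ge0 C20 (normr_ge0 y); lra.
apply: le_trans (_ : 2 * B / D ^+ 2 * y ^+ 2 <= _).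
  rewrite mulrAC ler_pdivlMr ?exprn_gt0//; apply: ler_wpM2l; first by rewrite mulr_ge0.
  by rewrite -(real_normK (num_real y)) lerXn2r// ?nnegrE// ltW.
by rewrite mulrDl; have := mulr_ge0 C10 (sqr_ge0 y); lra.
Qed.

End compactly_supported.

(** * Integration against the normal density *)

Section normal_integral.
Context {R : realType}.
Local Notation mu := (@lebesgue_measure R).

(** The Radon-Nikodym derivative and [normal_pdf] have equal integrals over every measurable set,
    hence agree almost everywhere. It turns a zero mean under the normal law into the Lebesgue
    integral that Stein's equation needs. *)
Lemma integral_normal_prob (m s : R) (f : R -> \bar R) :
  (normal_prob m s).-integrable setT f ->
  (\int[normal_prob m s]_x f x = \int[mu]_x (f x * (normal_pdf m s x)%:E))%E.
Proof.
move=> fi; rewrite -(Radon_Nikodym_change_of_variables (normal_prob_dominates m s))//=.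
have mf : measurable_fun setT f by case/integrableP: fi.
apply: ae_eq_integral => //.
- apply: emeasurable_funM => //; apply: (measurable_int mu).
  by apply: Radon_Nikodym_integrable; exact: normal_prob_dominates.
- by apply: emeasurable_funM => //=; apply/measurableT_comp => //=; exact: measurable_normal_pdf.
- apply: ae_eqe_mul2l => /=.
  rewrite Radon_NikodymE//=; first exact: normal_prob_dominates.
  move=> abmu; case: cid => /= h [h1 h2 h3].
  apply: integral_ae_eq => //=.
    by apply/measurableT_comp => //; exact: measurable_normal_pdf.
  by move=> E _ mE; rewrite -h3.
Qed.

End normal_integral.

(** * Stein's equation *)

Section stein_equation.
Context {R : realType}.
Local Notation mu := (@lebesgue_measure R).
Variables (s : R) (h : R -> R) (A : R).
Hypothesis s0 : 0 < s.
Hypothesis ch : continuous h.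
Hypothesis hA : forall x, A <= `|x| -> h x = 0.
Local Notation p := (normal_pdf 0 s).
Hypothesis hp0 : \int[mu]_x (h x * p x) = 0.

Let sN0 : s != 0. Proof. by rewrite gt_eqF. Qed.

Let hpi : mu.-integrable setT (EFin \o (fun x => h x * p x)).
Proof.
have [B B0 hB] := csupp_bounded ch hA.
have ip := integrable_normal_pdf 0 s.
apply: (le_integrable measurableT _ _ (integrableZl measurableT B ip)) => //=.
  apply/measurable_EFinP; apply: measurable_funM; first exact: continuous_measurable_fun.
  exact: measurable_normal_pdf.
move=> x _; rewrite lee_fin !normrM ler_wpM2r//.
by rewrite (le_trans (hB x))// ler_norm.
Qed.

(** The classical solution is [F / (s^2 p)]; [G] below is the factor [1 / (s^2 p)]. *)
Let F x := \int[mu]_(t in [set` Interval -oo%O (BRight x)]) (h t * p t).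

(** For negative [x], [h] vanishes on the whole range of integration. For [x >= 0] the tail beyond
    [x] contributes nothing, so [F x] is the total integral, zero by [hp0]. *)
Let F0 x : A <= `|x| -> F x = 0.
Proof.
have z0 D : (forall t, D t -> A <= `|t|) -> \int[mu]_(t in D) (h t * p t) = 0.
  move=> DA; rewrite (@eq_Rintegral _ _ _ mu D (fun=> 0)).
    by rewrite /Rintegral integral0.
  by move=> t /set_mem/DA/hA ->; rewrite mul0r.
have [x0|x0] := leP 0 x.
  rewrite ger0_norm// => Ax.
  have h1 : [set: R] = [set` Interval -oo%O (BRight x)] `|` [set` `]x, +oo[%R].
    apply/seteqP; split => // t _ /=; rewrite !in_itv/= andbT.
    by case: (leP t x); [left|right].
  move: hp0; rewrite h1 Rintegral_setU//.
  - rewrite [X in _ + X]z0 ?addr0// => t /=; rewrite in_itv/= andbT => xt.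
    by rewrite (le_trans Ax)// (le_trans (ltW xt))// ler_norm.
  - by rewrite -h1.
  - rewrite disj_set2E; apply/eqP; apply/seteqP; split => // t /=.
    rewrite !in_itv/= andbT => -[tx xt].
    by move: (le_lt_trans tx xt); rewrite ltxx.
rewrite ltr0_norm// => Ax; apply: z0 => t /=; rewrite in_itv/= => tx.
by rewrite (le_trans Ax)// -normrN (le_trans _ (ler_norm _))// lerN2.
Qed.

Let FD (x : R) : is_derive x 1 F (h x * p x).
Proof.
have x1 : x < x + 1 by rewrite ltrDl.
have ihp : mu.-integrable [set` Interval -oo%O (BRight (x + 1))] (EFin \o (fun t => h t * p t)).
  exact: integrableS hpi.
have chp : {for x, continuous (fun t => h t * p t)}.
  by apply: continuousM; [exact: ch|exact: continuous_normal_pdf].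
have [dF FE] := @continuous_FTC1 R _ -oo%O x (x + 1) x1 ihp ltac:(by rewrite ltNyr) chp.
by apply: DeriveDef => //; rewrite -derive1E.
Qed.

Let k := (s ^+ 2 * normal_peak s)^-1.
Let G x := k * expR (x ^+ 2 / (s ^+ 2 *+ 2)).

Let GE x : p x * G x = (s ^+ 2)^-1.
Proof.
rewrite normal_pdfE// /normal_fun /G /k subr0 mulNr expRN.
set E := expR _; have E0 : E != 0 by rewrite gt_eqF// expR_gt0.
have P0 : normal_peak s != 0 by rewrite gt_eqF// normal_peak_gt0.
by field; rewrite E0 P0 sN0.
Qed.

Let GD (x : R) : is_derive x 1 G (x / s ^+ 2 * G x).
Proof.
have e1 : is_derive x 1 (fun y : R => y ^+ 2 / (s ^+ 2 *+ 2)) (x / s ^+ 2).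
  apply: is_derive_eq; rewrite scaler0 add0r /GRing.scale/= mulr1.
  by field.
have e2 : is_derive x 1 (fun y : R => expR (y ^+ 2 / (s ^+ 2 *+ 2)))
    (expR (x ^+ 2 / (s ^+ 2 *+ 2)) * (x / s ^+ 2)).
  exact: (is_derive1_comp (is_derive_expR _) e1).
apply: is_derive_eq; rewrite /G /GRing.scale/=; ring.
Qed.

Let f (x : R) := F x * G x.
(** Read off from Stein's equation, so that its continuity follows from that of [h] and [f]. *)
Let f' (x : R) := (h x + x * f x) / s ^+ 2.

Lemma stein_solution : exists f f' : R -> R,
  [/\ forall x : R, is_derive x 1 f (f' x), continuous f',
      forall x, A <= `|x| -> f x = 0, forall x, A <= `|x| -> f' x = 0 &
      forall x, s ^+ 2 * f' x - x * f x = h x].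
Proof.
have df (x : R) : is_derive x 1 f (f' x).
  have FDx := FD x; have GDx := GD x.
  apply: is_derive_eq; rewrite /f' /f /GRing.scale/= mulrDl.
  have -> : h x / s ^+ 2 = h x * (p x * G x) by rewrite GE.
  ring.
have cf : continuous f.
  move=> x; apply: differentiable_continuous; apply/derivable1_diffP.
  by have [] := df x.
exists f, f'; split => //.
- move=> x; apply: cvgM; last exact: cvg_cst.
  by apply: cvgD; [exact: ch|apply: cvgM; [exact: cvg_id|exact: cf]].
- by move=> x Ax; rewrite /f F0// mul0r.
- by move=> x Ax; rewrite /f' /f F0// hA// !(mul0r, mulr0, addr0).
- by move=> x; rewrite /f'; field.
Qed.

End stein_equation.

(** By the mean value theorem the increment of [f] is [y * f' z] with [|z - x| <= |y|], and the
    modulus of [f'] increases with the distance. *)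
Lemma taylor_modulus {R : realType} (f f' : R -> R) (e C : R) :
  0 <= C ->
  (forall x : R, is_derive x 1 f (f' x)) ->
  (forall x y, `|f' (x + y) - f' x| <= e + C * y ^+ 2) ->
  forall x y, `|f (x + y) - f x - y * f' x| <= `|y| * (e + C * y ^+ 2).
Proof.
move=> C0 df mf' x y.
have cf D : {within D, continuous f}.
  apply: continuous_subspaceT => z; apply: differentiable_continuous.
  by apply/derivable1_diffP; have [] := df z.
have [z [zy ->]] : exists z, `|z - x| <= `|y| /\ f (x + y) - f x = f' z * y.
  have [y0|y0] := leP 0 y.
    have xy : x <= x + y by rewrite lerDl.
    have [z] := MVT_segment xy (fun z _ => df z) (cf _).
    rewrite in_itv/= => /andP[xz zy] ->; exists z; split; last by ring.
    by rewrite ger0_norm ?subr_ge0// ger0_norm// lerBlDl.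
  have xy : x + y <= x by rewrite gerDl ltW.
  have [z] := MVT_segment xy (fun z _ => df z) (cf _).
  rewrite in_itv/= => /andP[xz zy] hz; exists z; split.
    by rewrite ler0_norm ?subr_le0// ltr0_norm// lerNl opprK lerBrDl.
  by rewrite -[LHS]opprB hz; ring.
have -> : f' z * y - y * f' x = y * (f' (x + (z - x)) - f' x) by rewrite subrKC; ring.
rewrite normrM ler_wpM2l//; apply: le_trans (mf' _ _) _.
rewrite lerD2l ler_wpM2l// -(real_normK (num_real y)) -(real_normK (num_real (z - x))).
by rewrite lerXn2r// nnegrE.
Qed.

(** * Convergence to the normal law *)

Section cutoff.
Context {R : realType}.
Implicit Types (B x y : R).

(* the piecewise linear function equal to [max 0 (min 1 (B + 1 - |x|))] *)
Definition cutoff B x := (`|B + 1 - `|x| | - `|B - `|x| | + 1) / 2.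

Lemma cutoff01 B x : 0 <= cutoff B x <= 1.
Proof.
rewrite /cutoff; set t := `|x|.
by case: (lerP 0 (B + 1 - t)) => h1; case: (lerP 0 (B - t)) => h2;
  rewrite ?(ger0_norm h1) ?(ltr0_norm h1) ?(ger0_norm h2) ?(ltr0_norm h2); lra.
Qed.

Lemma cutoff1 B x : `|x| <= B -> cutoff B x = 1.
Proof. by move=> xB; rewrite /cutoff; move: `|x| xB => t xB; rewrite !ger0_norm; lra. Qed.

Lemma cutoff0 B x : B + 1 <= `|x| -> cutoff B x = 0.
Proof. by move=> xB; rewrite /cutoff; move: `|x| xB => t xB; rewrite !ler0_norm; lra. Qed.

Lemma continuous_cutoff B : continuous (cutoff B).
Proof.
have cabs b : continuous (fun x : R => `|b - `|x| |).
  move=> x; apply: cvg_norm.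
  by apply: cvgB; [exact: cvg_cst|exact: norm_continuous].
move=> x; apply: cvgM; last exact: cvg_cst.
apply: cvgD; last exact: cvg_cst.
by apply: cvgB; exact: cabs.
Qed.

Lemma cutoff_lip B x y : `|cutoff B x - cutoff B y| <= `|x - y|.
Proof.
have := ler_dist_dist x y; set d := `|x - y| => xy.
have h b : `| `|b - `|x| | - `|b - `|y| | | <= d.
  by apply: le_trans (ler_dist_dist _ _) _; rewrite opprB addrC subrKA distrC.
have := h (B + 1); have := h B; rewrite /cutoff !ler_norml; lra.
Qed.

(** Tightness of a single law, by dominated convergence. *)
Lemma cutoff_cvg (Q : probability (measurableTypeR R) R) e : 0 < e ->
  \forall n \near \oo, Ex Q (fun x => 1 - cutoff n%:R x) <= e.
Proof.
move=> e0.
have mc n : measurable_fun setT (fun x : measurableTypeR R => 1 - cutoff n%:R x).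
  by apply: measurable_funB => //; apply: continuous_measurable_fun; exact: continuous_cutoff.
have : (\int[Q]_x (1 - cutoff n%:R x)%:E)%E @[n --> \oo] --> (\int[Q]_x 0%:E)%E.
  apply: (@dominated_cvg _ _ _ _ _ _ _ _ (fun=> 1%E)) => //.
  - by move=> n; apply/measurable_EFinP; exact: mc.
  - move=> x _; apply: cvg_near_cst.
    apply: filterS (nbhs_infty_ger `|x|) => n xn.
    by rewrite cutoff1// subrr.
  - exact: finite_measure_integrable_cst.
  - move=> n x _; rewrite lee_fin; have /andP[? ?] := cutoff01 n%:R x.
    by rewrite ger0_norm; lra.
rewrite integral0 => /fine_cvgP[_ /cvgrPdist_le /(_ e e0)].
apply: filterS => n; rewrite sub0r normrN; apply: le_trans; exact: ler_norm.
Qed.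

End cutoff.

(** The summands are, in order, the truncation errors of the test function under the normal law and
    under [Y], the Stein error, and the two errors from multiplying the constant [r] by the
    cutoff. *)
Lemma error_budget {R : realType} (G t e eps : R) : G * t <= 2 * (G * e) ->
  (6 * G + 3) * e <= eps -> 0 < e -> G * e + G * t + e + G * t + G * e <= eps.
Proof. lra. Qed.

Section clt.
Context {R : realType} {d : measure_display} {Om : measurableType d}.
Variable P : probability Om R.
Variables (Y W : nat -> Om -> R) (Kw : R).
Hypothesis mY : forall k, measurable_fun setT (Y k).
Hypothesis mW : forall k, measurable_fun setT (W k).
Hypothesis iW2 : forall k, intg P (fun w => W k w ^+ 2).
Hypothesis iYW : forall k, intg P (fun w => `|Y k w - W k w|).
Hypothesis YW : forall e : R, 0 < e ->
  \forall k \near \oo, Ex P (fun w => `|Y k w - W k w|) <= e.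

Let comp_bounded (u : R -> R) (a : R) (Z : Om -> R) :
  measurable_fun setT u -> (forall x, `|u x| <= a) -> measurable_fun setT Z ->
  intg P (fun w => u (Z w)).
Proof.
move=> mu ua mZ; apply: (@intg_bounded _ _ _ P _ a) => //.
exact: measurableT_comp.
Qed.

(** If [|Y| >= D] then [|W| >= D / 2] or [|Y - W| >= D / 2]; in either case the oscillation of the
    test function is paid for by [W ^+ 2] or by [|Y - W|]. *)
Lemma cvg_in_distr_normal0 :
  (forall e : R, 0 < e -> \forall k \near \oo, Ex P (fun w => W k w ^+ 2) <= e) ->
  cvg_in_distr_normal P Y 0.
Proof.
move=> W0 g cg [G0 gG0]; rewrite /normal_expect eqxx.
pose G := `|G0| + 1; have Gp : 0 < G by rewrite ltr_wpDl.
have gG x : `|g x| <= G.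
  by rewrite (le_trans (gG0 x))// (le_trans (ler_norm _))// lerDl.
have mg : measurable_fun setT g by exact: continuous_measurable_fun.
have iY k : intg P (fun w => g (Y k w)) by exact: comp_bounded gG _.
apply: cvg_EFin; first by near=> k; rewrite Ex_fin.
apply/cvgrPdist_le => /= eps eps0.
have /cvgrPdist_le /(_ (eps / 2)) := cg 0.
rewrite divr_gt0// => /(_ isT) /nbhs_ballP[D /= D0 hD].
(* Chosen so that [C1 * (D / 2)^2] and [C2 * (D / 2)] both equal [2 * G], a bound for the
   oscillation. *)
pose C1 := 8 * G / D ^+ 2; pose C2 := 4 * G / D.
have C10 : 0 < C1 by rewrite divr_gt0 ?exprn_gt0// mulr_gt0.
have C20 : 0 < C2 by rewrite divr_gt0// mulr_gt0.
have key k w : `|g (Y k w) - g 0| <= eps / 2 + C1 * W k w ^+ 2 + C2 * `|Y k w - W k w|.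
  have t1 : 0 <= C1 * W k w ^+ 2 by rewrite mulr_ge0 ?sqr_ge0// ltW.
  have t2 : 0 <= C2 * `|Y k w - W k w| by rewrite mulr_ge0// ltW.
  have [yD|yD] := ltP `|Y k w| D.
    have := hD (Y k w); rewrite /ball/= sub0r normrN distrC => /(_ yD); lra.
  have hg : `|g (Y k w) - g 0| <= 2 * G.
    by apply: le_trans (ler_normB _ _) _; have := gG (Y k w); have := gG 0; lra.
  have [wD|wD] := leP (D / 2) `|W k w|.
    suff : 2 * G <= C1 * W k w ^+ 2 by lra.
    rewrite /C1 mulrAC ler_pdivlMr ?exprn_gt0//.
    have : (D / 2) ^+ 2 <= W k w ^+ 2.
      rewrite -(real_normK (num_real (W k w))) lerXn2r// ?nnegrE//.
      by rewrite divr_ge0// ltW.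
    by move=> h; have := ler_wpM2l (ltW Gp) h; lra.
  have yw : D / 2 <= `|Y k w - W k w|.
    have := ler_normD (Y k w - W k w) (W k w); rewrite subrK; lra.
  suff : 2 * G <= C2 * `|Y k w - W k w| by lra.
  rewrite /C2 mulrAC ler_pdivlMr//.
  by have := ler_wpM2l (ltW Gp) yw; lra.
have e1 : 0 < eps / 4 / C1 by apply: divr_gt0 => //; rewrite divr_gt0.
have e2 : 0 < eps / 4 / C2 by apply: divr_gt0 => //; rewrite divr_gt0.
apply: filterS2 (W0 _ e1) (YW e2) => k h1 h2.
have -> : g 0 - (fine \o (fun k => \int[P]_w (g (Y k w))%:E)%E) k =
    - Ex P (fun w => g (Y k w) - g 0).
  by rewrite ExB// ?Ex_cst ?opprB//; exact: intg_cst.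
rewrite normrN; apply: le_trans (Ex_abs_le _ _ (key k)) _.
- by apply: measurable_funB => //; exact: measurableT_comp.
- by apply: intgD; [apply: intgD; [exact: intg_cst|exact: intgZ]|exact: intgZ].
rewrite ExD; [|by apply: intgD; [exact: intg_cst|exact: intgZ]|exact: intgZ].
rewrite ExD; [|exact: intg_cst|exact: intgZ].
rewrite Ex_cst !ExZ//.
have := ler_wpM2l (ltW C10) h1; have := ler_wpM2l (ltW C20) h2.
rewrite !(mulrC C1 (_ / C1)) !(mulrC C2 (_ / C2)) !divfK ?gt_eqF//; lra.
Unshelve. all: by end_near. Qed.

Variable s : R.
Hypothesis s0 : 0 < s.
Hypothesis W2 : \forall k \near \oo, Ex P (fun w => W k w ^+ 2) <= Kw.
Hypothesis stein : forall f f' : R -> R,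
  (forall x : R, is_derive x 1 f (f' x)) -> continuous f' ->
  (exists A, forall x, A <= `|x| -> f x = 0 /\ f' x = 0) ->
  forall e : R, 0 < e -> \forall k \near \oo,
    `|Ex P (fun w => s ^+ 2 * f' (W k w) - W k w * f (W k w))| <= e.

Local Notation Q := (normal_prob (0 : R) s : probability (measurableTypeR R) R).

(** Through the solution of Stein's equation, [E h(W)] is the quantity that hypothesis [stein] makes
    small; the linear modulus of [h] then passes from [W] to [Y]. *)
Lemma csupp_cvg (h : R -> R) (A : R) : continuous h ->
  (forall x, A <= `|x| -> h x = 0) -> Ex Q h = 0 ->
  forall e : R, 0 < e -> \forall k \near \oo, `|Ex P (fun w => h (Y k w))| <= e.
Proof.
move=> ch hA Qh e e0.
have [Bh Bh0 hB] := csupp_bounded ch hA.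
have mh : measurable_fun setT h by exact: continuous_measurable_fun.
have hp0 : \int[lebesgue_measure]_x (h x * normal_pdf 0 s x) = 0.
  rewrite -[RHS]Qh /Ex /Rintegral integral_normal_prob//.
  by apply: (@intg_bounded _ _ _ Q _ Bh).
have [f [f' [df cf' f0 f'0 fE]]] := stein_solution s0 ch hA hp0.
have e3 : 0 < e / 3 by rewrite divr_gt0.
have [C C0 hC] := csupp_modulus ch hA e3.
have C1 : 0 < C + 1 by rewrite ltr_wpDl.
have e4 : 0 < e / 3 / (C + 1) by rewrite divr_gt0.
have sol := @stein f f' df cf' (ex_intro _ A (fun x Ax => conj (f0 x Ax) (f'0 x Ax))) _ e3.
apply: filterS2 sol (YW e4) => k h1 h2.
have ihY : intg P (fun w => h (Y k w)) by exact: comp_bounded hB _.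
have ihW : intg P (fun w => h (W k w)) by exact: comp_bounded hB _.
have hW : Ex P (fun w => h (W k w)) = Ex P (fun w => s ^+ 2 * f' (W k w) - W k w * f (W k w)).
  by congr Ex; apply/funext => w; rewrite fE.
have h3 : `|Ex P (fun w => h (Y k w) - h (W k w))| <= e / 3 + e / 3.
  apply: le_trans (_ : Ex P (fun w => e / 3 + C * `|Y k w - W k w|) <= _).
    apply: Ex_abs_le; first exact: intg_meas (intgB ihY ihW).
      by apply: intgD; [exact: intg_cst|exact: intgZ].
    by move=> w; have [+ _] := hC (W k w) (Y k w - W k w); rewrite subrKC.
  rewrite ExD; [|exact: intg_cst|exact: intgZ].
  rewrite Ex_cst ExZ// lerD2l.
  apply: le_trans (_ : (C + 1) * (e / 3 / (C + 1)) <= _); last first.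
    by rewrite mulrC divfK// gt_eqF.
  by apply: ler_pM => //; [exact: Ex_ge0|rewrite lerDl].
have -> : Ex P (fun w => h (Y k w)) =
    Ex P (fun w => h (Y k w) - h (W k w)) + Ex P (fun w => h (W k w)).
  by rewrite ExB// subrK.
apply: le_trans (ler_normD _ _) _; rewrite hW; lra.
Qed.

(** Write [g = g (1 - chi) + h + r - r (1 - chi)] with [h = (g - r) chi]. Then [h] is handled by
    [csupp_cvg], the constant [r] is common to both laws, and the rest is bounded by the mass of
    [1 - chi]. *)
Lemma cvg_in_distr_normal_stein : cvg_in_distr_normal P Y (s ^+ 2).
Proof.
move=> g cg [G0 gG0].
rewrite /normal_expect sqrf_eq0 gt_eqF// sqrtr_sqr gtr0_norm//.
pose G := `|G0| + 1; have Gp : 0 < G by rewrite ltr_wpDl.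
have gG x : `|g x| <= G.
  by rewrite (le_trans (gG0 x))// (le_trans (ler_norm _))// lerDl.
have mg : measurable_fun setT g by exact: continuous_measurable_fun.
have iY k : intg P (fun w => g (Y k w)) by exact: comp_bounded gG _.
have iQ (u : R -> R) (a : R) : continuous u -> (forall x, `|u x| <= a) -> intg Q u.
  by move=> cu ua; apply: (@intg_bounded _ _ _ Q _ a) => //; exact: continuous_measurable_fun.
have -> : (\int[normal_prob 0 s]_x (g x)%:E = (Ex Q g)%:E)%E.
  by rewrite -Ex_fin//; exact: iQ gG.
apply: cvg_EFin; first by near=> k; rewrite Ex_fin.
apply/cvgrPdist_le => /= eps eps0.
(* The bound [1/2] keeps the normal mass [rho] of the cutoff positive, as division by it defines
   [r]. *)
pose e1 := Num.min 2^-1 (eps / (6 * G + 3)).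
have G6 : 0 < 6 * G + 3 by rewrite addr_gt0// mulr_gt0.
have e10 : 0 < e1 by rewrite lt_min invr_gt0 ltr0n/= divr_gt0.
have e12 : e1 <= 2^-1 by rewrite ge_min lexx.
have e1e : (6 * G + 3) * e1 <= eps.
  by rewrite mulrC -ler_pdivlMr// ge_min lexx orbT.
have : exists n : nat, [/\ 1 <= n%:R :> R, Ex Q (fun x => 1 - cutoff n%:R x) <= e1 &
    Kw / e1 <= n%:R].
  apply: (@filter_ex _ (nbhs \oo)).
  have h2 := cutoff_cvg Q e10.
  have h1 := nbhs_infty_ger (1 : R); have h3 := nbhs_infty_ger (Kw / e1).
  by apply: filterS3 h1 h2 h3.
move=> [n [n1 Qn Kn]].
pose chi := @cutoff R n%:R.
have cchi : continuous chi by exact: continuous_cutoff.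
have mchi : measurable_fun setT chi by exact: continuous_measurable_fun.
have chi01 x : 0 <= chi x <= 1 := cutoff01 _ _.
have chiB x : `|chi x| <= 1 by have /andP[? ?] := chi01 x; rewrite ger0_norm.
have chiB' x : `|1 - chi x| <= 1.
  by have /andP[? ?] := chi01 x; rewrite ger0_norm; lra.
have cchi' : continuous (fun x => 1 - chi x).
  by move=> x; apply: cvgB; [exact: cvg_cst|exact: cchi].
have cgchi : continuous (fun x => g x * chi x).
  by move=> x; apply: cvgM; [exact: cg|exact: cchi].
have cgchi' : continuous (fun x => g x * (1 - chi x)).
  by move=> x; apply: cvgM; [exact: cg|exact: cchi'].
have gchiB x : `|g x * chi x| <= G by rewrite normrM -[leRHS]mulr1 ler_pM.
have gchiB' x : `|g x * (1 - chi x)| <= G by rewrite normrM -[leRHS]mulr1 ler_pM.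
pose rho := Ex Q chi.
have rhoE : rho = 1 - Ex Q (fun x => 1 - chi x).
  rewrite ExB; [|exact: intg_cst|exact: iQ chiB].
  by rewrite Ex_cst -/rho; ring.
have rho0 : 0 < rho by rewrite rhoE subr_gt0 (le_lt_trans Qn)// (le_lt_trans e12)// invf_lt1// ltr1n.
(* The multiple of the cutoff that gives [h] mean zero under the normal law. *)
pose r := Ex Q (fun x => g x * chi x) / rho.
have rG : `|r| <= G.
  rewrite /r normrM normfV (gtr0_norm rho0) ler_pdivrMr//.
  rewrite /rho -ExZ; last exact: iQ chiB.
  apply: Ex_abs_le; first exact: continuous_measurable_fun.
    by apply: intgZ; exact: iQ chiB.
  move=> x; have /andP[? _] := chi01 x.
  by rewrite normrM (ger0_norm (x := chi x))// ler_wpM2r.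
pose h x := g x * chi x - r * chi x.
have ch : continuous h.
  move=> x; apply: cvgB; first exact: cgchi.
  by apply: cvgM; [exact: cvg_cst|exact: cchi].
have hA x : n%:R + 1 <= `|x| -> h x = 0.
  by move=> nx; rewrite /h /chi cutoff0// !mulr0 subrr.
have Qh : Ex Q h = 0.
  rewrite /h ExB; [|exact: iQ gchiB|apply: intgZ; exact: iQ chiB].
  rewrite ExZ; last exact: iQ chiB.
  by rewrite -/rho /r divfK ?subrr// gt_eqF.
apply: filterS3 (csupp_cvg ch hA Qh e10) W2 (YW e10) => k h1 h2 h3.
pose X := Y k.
have mcomp (u : R -> R) : continuous u -> measurable_fun setT (fun w => u (X w)).
  by move=> cu; exact: (measurableT_comp (continuous_measurable_fun cu) (mY k)).
have iX (u : R -> R) (a : R) : continuous u -> (forall x, `|u x| <= a) -> intg P (fun w => u (X w)).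
  by move=> cu ua; exact: (comp_bounded (continuous_measurable_fun cu) ua (mY k)).
have [hb hb0 hB] := csupp_bounded ch hA.
have i1 := iX _ _ cgchi' gchiB'.
have i2 := iX _ _ ch hB.
have i3 := iX _ _ cchi' chiB'.
pose t := Ex P (fun w => 1 - chi (X w)).
have t0 : 0 <= t by apply: Ex_ge0 => w; have /andP[_ c1] := chi01 (X w); rewrite subr_ge0.
(* The cutoff is 1-Lipschitz, so [1 - chi(Y) <= W^2 / n^2 + |Y - W|]; since [n >= 1], [Kw / e1 <= n]
   also gives [Kw / n^2 <= e1]. *)
have t2 : t <= 2 * e1.
  have n20 : 0 < n%:R ^+ 2 :> R by rewrite exprn_gt0// (lt_le_trans ltr01).
  apply: le_trans (_ : Ex P (fun w => (n%:R ^+ 2)^-1 * W k w ^+ 2 + `|Y k w - W k w|) <= _).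
    apply: Ex_le => //; first by apply: intgD => //; exact: intgZ.
    move=> w; have hl := cutoff_lip n%:R (W k w) (X w).
    have hw : 1 - chi (W k w) <= (n%:R ^+ 2)^-1 * W k w ^+ 2.
      have /andP[c0 c1] := chi01 (W k w).
      have [Wn|Wn] := leP `|W k w| n%:R.
        by rewrite /chi cutoff1// subrr mulr_ge0 ?sqr_ge0// invr_ge0 ltW.
      apply: le_trans (_ : 1 <= _); first lra.
      rewrite mulrC ler_pdivlMr// mul1r -(real_normK (num_real (W k w))).
      by rewrite lerXn2r// ?nnegrE// ltW.
    have hd : chi (W k w) - chi (X w) <= `|Y k w - W k w|.
      by apply: le_trans (ler_norm _) _; apply: le_trans hl _; rewrite distrC.
    by have := lerD hw hd; rewrite addrA subrK.
  rewrite ExD//; last exact: intgZ.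
  rewrite ExZ//.
  have : (n%:R ^+ 2)^-1 * Ex P (fun w => W k w ^+ 2) <= e1.
    rewrite mulrC ler_pdivrMr//; apply: le_trans h2 _.
    rewrite mulrC -ler_pdivrMr//; apply: le_trans Kn _.
    by rewrite expr2 ler_peMl.
  by lra.
have gE w : g (X w) = g (X w) * (1 - chi (X w)) + h (X w) + r - r * (1 - chi (X w)).
  by rewrite /h; ring.
have EgX : Ex P (fun w => g (X w)) =
    Ex P (fun w => g (X w) * (1 - chi (X w))) + Ex P (fun w => h (X w)) + r - r * t.
  rewrite (_ : (fun w => g (X w)) =
    (fun w => g (X w) * (1 - chi (X w)) + h (X w) + r - r * (1 - chi (X w)))); last first.
    by apply/funext => w; rewrite -gE.
  have i4 := intg_cst P r.
  rewrite ExB; [|by apply: intgD => //; exact: intgD|exact: intgZ].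
  rewrite ExD//; last exact: intgD.
  by rewrite ExD// Ex_cst ExZ.
have EQg : Ex Q g = r * rho + Ex Q (fun x => g x * (1 - chi x)).
  rewrite /r divfK ?gt_eqF// -ExD; [|exact: iQ gchiB|exact: iQ gchiB'].
  by congr Ex; apply/funext => x; ring.
have b1 : `|Ex P (fun w => g (X w) * (1 - chi (X w)))| <= G * t.
  rewrite /t -ExZ//; apply: Ex_abs_le; [exact: intg_meas i1|exact: intgZ|].
  move=> w; have /andP[_ ?] := chi01 (X w).
  by rewrite normrM (ger0_norm (x := 1 - _)) ?subr_ge0// ler_wpM2r// subr_ge0.
have q0 : 0 <= Ex Q (fun x => 1 - chi x).
  by apply: Ex_ge0 => x; have /andP[_ ?] := chi01 x; rewrite subr_ge0.
have b2 : `|Ex Q (fun x => g x * (1 - chi x))| <= G * e1.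
  apply: le_trans (_ : G * Ex Q (fun x => 1 - chi x) <= _); last by rewrite ler_wpM2l// ltW.
  rewrite -ExZ; last exact: iQ chiB'.
  apply: Ex_abs_le; first exact: continuous_measurable_fun.
    by apply: intgZ; exact: iQ chiB'.
  move=> x; have /andP[_ ?] := chi01 x.
  by rewrite normrM (ger0_norm (x := 1 - _)) ?subr_ge0// ler_wpM2r// subr_ge0.
have -> : Ex Q g - (fine \o (fun k => \int[P]_w (g (Y k w))%:E)%E) k =
    Ex Q (fun x => g x * (1 - chi x)) - Ex P (fun w => g (X w) * (1 - chi (X w)))
    - Ex P (fun w => h (X w)) + r * t - r * Ex Q (fun x => 1 - chi x).
  rewrite EQg /= -/(Ex P (fun w => g (X w))) EgX rhoE; ring.
have b3 : `|r * t| <= G * t by rewrite normrM (ger0_norm t0) ler_wpM2r.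
have b4 : `|r * Ex Q (fun x => 1 - chi x)| <= G * e1.
  by rewrite normrM (ger0_norm q0) ler_pM// ltW.
have b5 : G * t <= 2 * (G * e1) by rewrite mulrCA ler_wpM2l// ltW.
have b6 : G * e1 + G * t + e1 + G * t + G * e1 <= eps.
  exact: error_budget b5 e1e e10.
apply: le_trans b6; apply: le_trans (ler_normB _ _) (lerD _ b4).
apply: le_trans (ler_normD _ _) (lerD _ b3).
apply: le_trans (ler_normB _ _) (lerD _ h1).
exact: le_trans (ler_normB _ _) (lerD b2 b1).
Unshelve. all: by end_near. Qed.

End clt.

(** * Law of large numbers *)

Lemma ident_distr_Ex {R : realType} {d : measure_display} {Om : measurableType d}
    (P : probability Om R) (X Y : Om -> R) (u : R -> R) :
  measurable_fun setT X -> measurable_fun setT Y -> measurable_fun setT u ->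
  ident_distr P X Y -> intg P (fun w => u (X w)) -> intg P (fun w => u (Y w)) ->
  Ex P (fun w => u (X w)) = Ex P (fun w => u (Y w)).
Proof.
move=> mX mY mu XY iX iY.
pose X' : {RV P >-> R} := HB.pack X (isMeasurableFun.Build _ _ _ _ _ mX).
pose Y' : {RV P >-> R} := HB.pack Y (isMeasurableFun.Build _ _ _ _ _ mY).
have mu' : measurable_fun setT (EFin \o u) by exact/measurable_EFinP.
have E (V : {RV P >-> R}) : intg P (fun w => u (V w)) ->
    (\int[distribution P V]_x (u x)%:E = \int[P]_w (u (V w))%:E)%E.
  move=> iV; rewrite integral_distribution//.
rewrite /Ex -(E X' iX) -(E Y' iY); congr fine.
by apply: eq_measure_integral => B mB _; exact: XY.
Qed.

(** A sum over pairs depends only on the sum and the sum of squares. This identity simplifies both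
    the CD statistic and [qvar]. *)
Lemma pair_sum {R : numFieldType} (n : nat) (x : nat -> R) :
  \sum_(i < n) \sum_(j < i) x i * x j =
  ((\sum_(i < n) x i) ^+ 2 - \sum_(i < n) x i ^+ 2) / 2.
Proof.
elim: n => [|n IH]; first by rewrite !big_ord0 expr0n subrr mul0r.
rewrite !big_ord_recr/= IH -mulr_sumr.
set s := \sum_(i < n) x i; set q := \sum_(i < n) _.
by field.
Qed.

Section law_of_large_numbers.
Context {R : realType} {d : measure_display} {Om : measurableType d}.
Variables (P : probability Om R) (X : nat -> Om -> R).
(** [V] is the full independent family and [inj] selects a sequence in it, so that the result
    applies to the [sigma] part of [vars]. *)
Context {I : eqType} (V : I -> Om -> R) (inj : nat -> I).
Hypothesis mV : forall i, measurable_fun setT (V i).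
Hypothesis indV : mutually_independent P V.
Hypothesis inj_inj : injective inj.
Variables (u : R -> R) (b : R).
Hypothesis mu : measurable_fun setT u.
Hypothesis ub : forall i w, `|u (V (inj i) w)| <= b.
Hypothesis idV : forall i, ident_distr P (V (inj i)) (V (inj 0%N)).

Let U i w := u (V (inj i) w).
Let mean := Ex P (U 0).
Let Z i w := U i w - mean.
Let mU i : measurable_fun setT (U i). Proof. exact: measurableT_comp. Qed.
Let iU i : intg P (U i). Proof. exact: intg_bounded (mU i) (ub i). Qed.
Let b0 : 0 <= b. Proof. exact: le_trans (normr_ge0 _) (ub 0 point). Qed.

Let Zb i w : `|Z i w| <= 2 * b.
Proof.
have mb : `|mean| <= b.
  rewrite -(Ex_cst P b); apply: Ex_abs_le; [exact: mU|exact: intg_cst|exact: ub].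
by apply: le_trans (ler_normB _ _) _; have := ub i w; rewrite -/(U i w); lra.
Qed.

Let mZ i : measurable_fun setT (Z i). Proof. exact: measurable_funB. Qed.
Let ZL p i : Lp P p (Z i). Proof. exact: Lp_bounded (mZ i) (Zb i). Qed.

Let EZ i : Ex P (Z i) = 0.
Proof.
rewrite ExB//; last exact: intg_cst.
by rewrite Ex_cst (ident_distr_Ex (mV _) (mV _) mu (idV i) (iU i) (iU 0)) subrr.
Qed.

Lemma lln_L2 n : Ex P (fun w => (\sum_(i < n) Z i w) ^+ 2) <= 4 * b ^+ 2 * n%:R.
Proof.
elim: n => [|n IH].
  rewrite mulr0 -[leRHS](Ex_cst P) le_eqVlt.
  by apply/orP; left; apply/eqP; congr Ex; apply/funext => w; rewrite big_ord0 expr0n.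
pose S w := \sum_(i < n) Z i w.
have oS : omeas V (inj n) S.
  apply: omeas_sum => i; apply: omeasB; last exact: omeas_cst.
  apply: omeas_comp => //; apply: omeasX.
  by rewrite (inj_eq inj_inj) neq_ltn ltn_ord.
have SL p : Lp P p S by apply: Lp_sum => i; exact: ZL.
have iS := Lp1_intg (SL 1%N).
have mphi : measurable_fun setT (fun x => u x - mean) by exact: measurable_funB.
have [i1 E1] := @indep_other _ _ _ P _ V mV indV (inj n) (fun x => u x - mean) S mphi
  (Lp1_intg (ZL 1%N n)) oS iS.
rewrite EZ mul0r in E1.
have i2 : intg P (fun w => S w ^+ 2) by apply: Lp1_intg; exact: LpX.
have i3 : intg P (fun w => Z n w ^+ 2) by apply: Lp1_intg; exact: LpX.
have -> : Ex P (fun w => (\sum_(i < n.+1) Z i w) ^+ 2) =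
    Ex P (fun w => S w ^+ 2) + 2 * Ex P (fun w => Z n w * S w) + Ex P (fun w => Z n w ^+ 2).
  rewrite -ExZ// -!ExD//; [|by apply: intgD => //; exact: intgZ|exact: intgZ].
  by congr Ex; apply/funext => w; rewrite big_ord_recr/= -/(S w); ring.
rewrite E1 mulr0 addr0 -[n.+1%:R]natr1 mulrDr mulr1; apply: lerD => //.
rewrite -(Ex_cst P (4 * b ^+ 2)); apply: Ex_le => //; first exact: intg_cst.
move=> w; have -> : 4 * b ^+ 2 = (2 * b) ^+ 2 by ring.
by rewrite -(real_normK (num_real (Z n w))) lerXn2r// ?nnegrE ?mulr_ge0.
Qed.

(** The inequality [|x| <= e/2 + x^2 / (e/2)] converts the L^2 bound into an L^1 bound. *)
Lemma lln_L1 e : 0 < e -> exists N0, forall n, (N0 <= n)%N ->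
  Ex P (fun w => `|n%:R^-1 * \sum_(i < n) u (V (inj i) w) - mean|) <= e.
Proof.
(* The quadratic term becomes [(e/2) * B / n], at most [e/2] once [n >= B]; the additional 1 below
   makes [n] positive. *)
move=> e0; pose B := 4 * b ^+ 2 / (e / 2) ^+ 2.
have e20 : 0 < e / 2 by rewrite divr_gt0.
have [n0 hn0] : exists n0 : nat, B + 1 <= n0%:R.
  have [n0 _ h] := nbhs_infty_ger (B + 1); exists n0; exact: (h n0 (leqnn n0)).
exists n0 => n n0n.
have B0 : 0 <= B by apply: divr_ge0; rewrite ?sqr_ge0// mulr_ge0// sqr_ge0.
have Bn : B + 1 <= n%:R by apply: le_trans hn0 _; rewrite ler_nat.
have np : 0 < n%:R :> R by lra.
have E w : n%:R^-1 * \sum_(i < n) u (V (inj i) w) - mean = n%:R^-1 * \sum_(i < n) Z i w.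
  rewrite /Z sumrB sumr_const card_ord mulrBr -[mean *+ n]mulr_natl mulrA mulVf ?mul1r//.
  by rewrite gt_eqF.
pose S w := \sum_(i < n) Z i w.
have SL p : Lp P p S by apply: Lp_sum => i; exact: ZL.
have iS2 : intg P (fun w => S w ^+ 2) by apply: Lp1_intg; exact: LpX.
apply: le_trans (_ : Ex P (fun w => e / 2 + ((e / 2)^-1 * n%:R ^- 2) * S w ^+ 2) <= _).
  apply: Ex_le.
  - apply: intg_abs; under [X in intg _ X]eq_fun do rewrite E.
    by apply: intgZ; exact: Lp1_intg (SL 1%N).
  - by apply: intgD; [exact: intg_cst|exact: intgZ].
  move=> w; rewrite E -/(S w); set x := n%:R^-1 * S w.
  have -> : (e / 2)^-1 * n%:R ^- 2 * S w ^+ 2 = (e / 2)^-1 * `|x| ^+ 2.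
    by rewrite real_normK ?num_real// /x exprMn exprVn [RHS]mulrA.
  have [xe|xe] := leP `|x| (e / 2).
    apply: ler_wpDr => //; apply: mulr_ge0; last exact: sqr_ge0.
    by rewrite invr_ge0; exact: ltW.
  apply: ler_wpDl; first exact: ltW.
  rewrite mulrC expr2 -mulrA; apply: ler_peMr => //.
  by rewrite ler_pdivlMr// mul1r; exact: ltW.
rewrite ExD; [|exact: intg_cst|exact: intgZ].
rewrite Ex_cst ExZ//.
have c0 : 0 <= (e / 2)^-1 * n%:R ^- 2 by apply: mulr_ge0; rewrite invr_ge0 ?sqr_ge0//; exact: ltW.
have := ler_wpM2l c0 (lln_L2 n).
suff : (e / 2)^-1 * n%:R ^- 2 * (4 * b ^+ 2 * n%:R) <= e / 2 by lra.
have -> : (e / 2)^-1 * n%:R ^- 2 * (4 * b ^+ 2 * n%:R) = (e / 2) * B / n%:R.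
  by rewrite /B; field; rewrite !gt_eqF.
rewrite ler_pdivrMr//; apply: ler_wpM2l; [exact: ltW|lra].
Qed.

End law_of_large_numbers.

(** * The remainder term *)

Lemma exchange_pair_sum {R : nmodType} (N T : nat) (F : nat -> nat -> nat -> R) :
  \sum_(i < N) \sum_(j < i) \sum_(t < T) F i j t =
  \sum_(t < T) \sum_(i < N) \sum_(j < i) F i j t.
Proof. by rewrite exchange_big/=; under eq_bigr do rewrite exchange_big/=. Qed.

Section remainder.
Context {R : realType} {d : measure_display} {Om : measurableType d}.
Variables (sigma : nat -> Om -> R) (eta : nat -> nat -> Om -> R) (tau : nat -> R).

Definition cdscale (N T : nat) : R := Num.sqrt (2 / (T%:R * N%:R * (N%:R - 1))).

(** This is the weight [g_i] wherever [sigma_i] is nonzero; in the form given, [CDleadE] holds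
    without side condition. *)
Definition demeaned (N i : nat) (w : Om) : R :=
  sigma i w * ((sigma i w)^-1 - sinvbar N sigma w).

(* [1 / sigma_i], written so that [isigma i * eta i t] is [epsilon i t / sigma_i ^+ 2]
   even at [sigma_i = 0] *)
Definition isigma (i : nat) (w : Om) : R := sigma i w * (sigma i w)^-1 ^+ 2.

(** With [S_t = sum_i eps_it], the summand is [(S_t / N) sum_i eps_it / sigma_i^2 - (S_t / N)^2
    sum_i sigma_i^-2 / 2]. Both linear forms are of order [sqrt N] in L^2, so the summand is [O(1)]
    in L^1. *)
Definition remainder (N T : nat) (w : Om) : R :=
  cdscale N T * \sum_(t < T)
    (lin eta sigma N t w / N%:R * lin eta isigma N t w -
     (lin eta sigma N t w / N%:R) ^+ 2 * (\sum_(i < N) (sigma i w)^-1 ^+ 2) / 2).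

Lemma CDleadE N T w : CDlead N T sigma eta w = wsum eta (demeaned N) N (cdscale N T) T w.
Proof.
rewrite /CDlead /wsum /quad -/(cdscale N T); congr (_ * _).
rewrite (exchange_pair_sum N T (fun i j t => epsilon sigma eta i t w * epsilon sigma eta j t w *
  ((sigma i w)^-1 - sinvbar N sigma w) * ((sigma j w)^-1 - sinvbar N sigma w))).
apply: eq_bigr => t _; apply: eq_bigr => i _; apply: eq_bigr => j _.
by rewrite /epsilon /demeaned; ring.
Qed.

Lemma cdscale_Xi N T : (1 < N)%N -> (0 < T)%N ->
  Num.sqrt T%:R * (Num.sqrt (N%:R / (2 * (N%:R - 1))) * (N%:R * T%:R)^-1) =
  cdscale N T / 2.
Proof.
move=> N1 T0.
have n0 : 0 < N%:R :> R by rewrite ltr0n ltnW.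
have n1 : 0 < N%:R - 1 :> R by rewrite subr_gt0 ltr1n.
have t0 : 0 < T%:R :> R by rewrite ltr0n.
have p0 : 0 <= N%:R / (2 * (N%:R - 1)) :> R by rewrite divr_ge0// mulr_ge0// ltW.
have q0 : 0 <= 2 / (T%:R * N%:R * (N%:R - 1)) :> R.
  by rewrite divr_ge0// !mulr_ge0// ltW.
apply: (@pexpIrn _ 2) => //.
- by rewrite nnegrE !mulr_ge0 ?sqrtr_ge0// invr_ge0 mulr_ge0.
- by rewrite nnegrE divr_ge0 ?sqrtr_ge0.
- rewrite /cdscale !exprMn !sqr_sqrtr//.
  by field; rewrite !gt_eqF.
Qed.

(** With [r_i] the scaled residual and [q_i] the lead factor, [pair_sum] leaves half of
    [sum q_i^2 - sum r_i^2]. Removing the [Xi] summand turns [q_i^2] into [eps_i^2 / sigma_i^2], and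
    expanding [r_i^2] cancels this. *)
Lemma remainderE N T w : (1 < N)%N -> (0 < T)%N -> (forall i, sigma i w != 0) ->
  CDstat N T tau sigma eta w - CDlead N T sigma eta w -
    Num.sqrt T%:R * Xi N T sigma eta w = remainder N T w.
Proof.
move=> N1 T0 s0.
have n0 : N%:R != 0 :> R by rewrite pnatr_eq0 -lt0n ltnW.
pose e i t := sigma i w * eta i t w; pose a i := (sigma i w)^-1.
pose ab := sinvbar N sigma w.
pose S t := \sum_(i < N) e i t.
have rE i t : resid N tau sigma eta i t w = e i t - S t / N%:R.
  rewrite /resid /tauhat /yobs big_split/= sumr_const card_ord.
  rewrite -[\sum_(i0 < N) _]/(S t) -[tau t *+ N]mulr_natl -[epsilon _ _ _ _ _]/(e i t).
  by field.
rewrite /Xi !mulrA -!mulrA (mulrA (Num.sqrt T%:R)) (mulrA (_ * _)) -(mulrA (Num.sqrt T%:R)).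
rewrite (cdscale_Xi N1 T0) /CDstat /CDlead -/(cdscale N T).
rewrite (exchange_pair_sum N T (fun i j t => resid N tau sigma eta i t w *
  resid N tau sigma eta j t w / (sigma i w * sigma j w))).
rewrite (exchange_pair_sum N T (fun i j t => epsilon sigma eta i t w * epsilon sigma eta j t w *
  ((sigma i w)^-1 - sinvbar N sigma w) * ((sigma j w)^-1 - sinvbar N sigma w))).
rewrite [X in _ / 2 * X]exchange_big/= -mulrBr -mulrA -mulrBr /remainder; congr (_ * _).
rewrite mulr_sumr -!sumrB; apply: eq_bigr => t _.
pose r i := (e i t - S t / N%:R) * a i.
pose q i := e i t * (a i - ab).
rewrite (_ : \sum_(i < N) \sum_(j < i) _ = \sum_(i < N) \sum_(j < i) r i * r j); last first.
  apply: eq_bigr => i _; apply: eq_bigr => j _; rewrite !rE /r /a.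
  by field; rewrite n0 !s0.
rewrite (_ : \sum_(i < N) \sum_(j < i) (epsilon _ _ _ _ _ * _ * _ * _) =
    \sum_(i < N) \sum_(j < i) q i * q j); last first.
  apply: eq_bigr => i _; apply: eq_bigr => j _.
  by rewrite /q /e /epsilon /a /ab; ring.
rewrite !pair_sum.
(* Both sums equal [sum e_i a_i - S * ab], since the [a_i] sum to [N * ab]. *)
have -> : \sum_(i < N) r i = \sum_(i < N) q i.
  have abE : \sum_(i < N) a i = N%:R * ab by rewrite /ab /sinvbar mulrA divff// mul1r.
  rewrite (eq_bigr (fun i : 'I_N => e i t * a i - S t / N%:R * a i)); last first.
    by move=> i _; rewrite /r; ring.
  rewrite [RHS](eq_bigr (fun i : 'I_N => e i t * a i - e i t * ab)); last first.
    by move=> i _; rewrite /q; ring.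
  rewrite !sumrB -mulr_sumr -mulr_suml abE -/(S t).
  by congr (_ - _); field.
have -> : lin eta sigma N t w = S t by [].
set Q := (\sum_(i < N) q i) ^+ 2.
have -> : (Q - \sum_(i < N) r i ^+ 2) / 2 - (Q - \sum_(i < N) q i ^+ 2) / 2 -
    2^-1 * (\sum_(i < N) epsilon sigma eta i t w ^+ 2 *
      (sinvbar N sigma w ^+ 2 - 2 * sinvbar N sigma w * (sigma i w)^-1)) =
  \sum_(i < N) 2^-1 * (q i ^+ 2 - r i ^+ 2 - e i t ^+ 2 * (ab ^+ 2 - 2 * ab * a i)).
  rewrite -mulr_sumr !sumrB -/ab -/a; set z1 := \sum_(i < N) r i ^+ 2.
  set z2 := \sum_(i < N) q i ^+ 2; set z3 := \sum_(i < N) _.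
  by field.
rewrite (eq_bigr (fun i : 'I_N => S t / N%:R * (sigma i w * (sigma i w)^-1 ^+ 2 * eta i t w)
   - (S t / N%:R) ^+ 2 / 2 * (sigma i w)^-1 ^+ 2)); last first.
  move=> i _; rewrite /q /r /e /a; field; by rewrite n0 s0.
rewrite sumrB -!mulr_sumr /lin /isigma; congr (_ - _).
by rewrite mulrAC.
Qed.

End remainder.

(** * The CD statistic *)

Section scale.
Context {R : realType}.
Variables (N T : nat).
Hypotheses (N1 : (1 < N)%N) (T0 : (0 < T)%N).
Local Notation c := (@cdscale R N T).

Let n2 : 2 <= N%:R :> R. Proof. by rewrite ler_nat. Qed.
Let t0 : 0 < T%:R :> R. Proof. by rewrite ltr0n. Qed.

Lemma cdscale_ge0 : 0 <= c. Proof. exact: sqrtr_ge0. Qed.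

Lemma cdscale_sqr : c ^+ 2 * T%:R = 2 / (N%:R * (N%:R - 1)).
Proof.
have h2 := n2; have ht := t0.
rewrite sqr_sqrtr; last by apply: divr_ge0 => //; rewrite !mulr_ge0//; lra.
by field; rewrite !gt_eqF//; lra.
Qed.

Lemma cdscale_sqr_le : c ^+ 2 * T%:R * N%:R ^+ 2 <= 4.
Proof.
have h2 := n2; have ht := t0.
rewrite cdscale_sqr; have -> : 2 / (N%:R * (N%:R - 1)) * N%:R ^+ 2 = 2 * N%:R / (N%:R - 1) :> R.
  by field; rewrite !gt_eqF//; lra.
rewrite ler_pdivrMr; lra.
Qed.

Lemma cdscale_le : c * T%:R <= 2 * (Num.sqrt T%:R / N%:R).
Proof.
have h2 := n2; have ht := t0.
have st := sqr_sqrtr (ltW t0).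
have hx : 0 <= c * T%:R by rewrite mulr_ge0 ?cdscale_ge0// ltW.
have hy : 0 <= 2 * (Num.sqrt T%:R / N%:R) :> R.
  by rewrite mulr_ge0// divr_ge0 ?sqrtr_ge0.
rewrite -(@ler_pXn2r _ 2) ?nnegrE//.
have -> : (2 * (Num.sqrt T%:R / N%:R)) ^+ 2 = 4 * T%:R / N%:R ^+ 2 :> R.
  by rewrite !exprMn exprVn st; ring.
have np : 0 < N%:R :> R by lra.
rewrite ler_pdivlMr ?exprn_gt0//.
have := ler_wpM2r (ltW t0) cdscale_sqr_le.
by rewrite (_ : c ^+ 2 * T%:R * N%:R ^+ 2 * T%:R = (c * T%:R) ^+ 2 * N%:R ^+ 2)//; ring.
Qed.

(** With [x = c^2 * T * N^2 <= 4] the two parts are [2 e B x] and [C K x^2 / T]: the first is small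
    with [e], the second for large [T]. *)
Lemma stein_scale (e B C K : R) : 0 <= e -> 0 <= B -> 0 <= C -> 0 <= K ->
  T%:R * (2 * e * c ^+ 2 * (B * N%:R ^+ 2) + C * c ^+ 4 * (K * N%:R ^+ 4)) <=
  8 * (e * B) + 16 * (C * K) / T%:R.
Proof.
move=> e0 B0 C0 K0.
set x := c ^+ 2 * T%:R * N%:R ^+ 2.
have x0 : 0 <= x.
  by apply: mulr_ge0; rewrite ?sqr_ge0//; apply: mulr_ge0; rewrite ?sqr_ge0//; exact: ltW.
have x4 : x <= 4 := cdscale_sqr_le.
have -> : T%:R * (2 * e * c ^+ 2 * (B * N%:R ^+ 2) + C * c ^+ 4 * (K * N%:R ^+ 4)) =
    2 * (e * B) * x + C * K * x ^+ 2 / T%:R.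
  by rewrite /x; field; rewrite gt_eqF.
apply: lerD.
  have := ler_wpM2l (mulr_ge0 e0 B0) x4; lra.
rewrite ler_pM2r ?invr_gt0//.
have x16 : x ^+ 2 <= 16.
  by rewrite (_ : 16 = 4 ^+ 2); [rewrite lerXn2r// nnegrE|ring].
have := ler_wpM2l (mulr_ge0 C0 K0) x16; lra.
Qed.

End scale.

Section assumption.
Context {R : realType} {d : measure_display} {Om : measurableType d}.
Variables (P : probability Om R) (sigma : nat -> Om -> R) (eta : nat -> nat -> Om -> R).
Variables (tau : nat -> R) (delta M : R).
Hypothesis meta : forall i t, measurable_fun setT (eta i t).
Hypothesis eta1 : forall i t, (\int[P]_w (eta i t w)%:E = 0)%E.
Hypothesis eta2 : forall i t, (\int[P]_w (eta i t w ^+ 2)%:E = 1)%E.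
Hypothesis eta8 : forall i t, (\int[P]_w (eta i t w ^+ 8)%:E < M%:E)%E.
Hypotheses (delta0 : 0 < delta) (deltaM : delta < M).
Hypothesis msigma : forall i, measurable_fun setT (sigma i).
Hypothesis sigmaB : forall i w, delta <= sigma i w <= M.
Hypothesis idsigma : forall i, ident_distr P (sigma i) (sigma 0%N).
Hypothesis indep : mutually_independent P (vars sigma eta).

Let A := delta^-1.
Let M0 : 0 < M. Proof. exact: lt_trans deltaM. Qed.
Let A0 : 0 < A. Proof. by rewrite invr_gt0. Qed.

Let mvars k : measurable_fun setT (vars sigma eta k).
Proof. by case: k => [i|[i t]] /=. Qed.

Let eta8L i t : Lp P 8 (eta i t).
Proof.
split => //; apply/integrableP; split.
  by apply/measurable_EFinP; apply: measurable_funX; exact: measurableT_comp.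
apply: le_lt_trans (lt_trans (eta8 i t) (ltry M)).
rewrite le_eqVlt; apply/orP; left; apply/eqP; apply: eq_integral => w _ /=.
rewrite normrX normr_id; congr (_%:E).
by rewrite -normrX ger0_norm// exprn_even_ge0.
Qed.

Let Eeta i t : Ex P (eta i t) = 0. Proof. by rewrite /Ex eta1. Qed.
Let Eeta2 i t : Ex P (fun w => eta i t w ^+ 2) = 1. Proof. by rewrite /Ex eta2. Qed.

(** From [x <= 1 + x^2] at [x = eta^4]; thus [1 + M] is the constant [K4] of the moment bounds. *)
Let Eeta4 i t : Ex P (fun w => eta i t w ^+ 4) <= 1 + M.
Proof.
have i8 : intg P (fun w => eta i t w ^+ 8) by apply: Lp1_intg; exact: LpX.
have i4 : intg P (fun w => eta i t w ^+ 4).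
  by apply: Lp1_intg; apply: LpX; exact: Lp_le (eta8L i t).
apply: le_trans (_ : Ex P (fun w => 1 + eta i t w ^+ 8) <= _).
  apply: Ex_le => //; first by apply: intgD => //; exact: intg_cst.
  move=> w; have -> : eta i t w ^+ 8 = (eta i t w ^+ 4) ^+ 2 by rewrite -exprM.
  move: (eta i t w ^+ 4) => x; have := sqr_ge0 (x - 2^-1); nra.
rewrite ExD//; last exact: intg_cst.
by rewrite Ex_cst lerD2l -lee_fin -Ex_fin// ltW.
Qed.

Let s0 i w : 0 < sigma i w.
Proof. by have /andP[+ _] := sigmaB i w; exact: lt_le_trans. Qed.

Let sN0 i w : sigma i w != 0. Proof. by rewrite gt_eqF. Qed.

Let sB i w : `|sigma i w| <= M.
Proof. by rewrite gtr0_norm//; have /andP[] := sigmaB i w. Qed.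

Let iB i w : 0 <= (sigma i w)^-1 <= A.
Proof. by rewrite invr_ge0 ltW//= lef_pV2 ?posrE//; have /andP[] := sigmaB i w. Qed.

(* a continuous function on the line that is [x^-1] for [delta <= x] *)
Let tinv (x : R) := ((delta + x + `|x - delta|) / 2)^-1.

Let tinvE i w : tinv (sigma i w) = (sigma i w)^-1.
Proof.
have /andP[h _] := sigmaB i w; rewrite /tinv ger0_norm ?subr_ge0//.
by congr (_^-1); field.
Qed.

Let mtinv : measurable_fun setT tinv.
Proof.
apply: continuous_measurable_fun => x; apply: cvgV.
  rewrite gt_eqF//; have := ler_norm (x - delta); have := ler_norm (delta - x).
  rewrite distrC; move: delta0; lra.
apply: cvgM; last exact: cvg_cst.
apply: cvgD; first by apply: cvgD; [exact: cvg_cst|exact: cvg_id].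
by apply: cvg_norm; apply: cvgB; [exact: cvg_id|exact: cvg_cst].
Qed.

Let ss i : smeas sigma eta (sigma i). Proof. exact: smeas_sigma. Qed.

Let si i : smeas sigma eta (fun w => (sigma i w)^-1).
Proof.
move=> j t; rewrite (_ : (fun w => _) = (fun w => tinv (sigma i w))).
  by apply: omeas_comp => //; exact: ss.
by apply/funext => w; rewrite tinvE.
Qed.

Let sis i : smeas sigma eta (isigma sigma i).
Proof. by move=> j t; apply: omeasM; [exact: ss|apply: omeasXn; exact: si]. Qed.

Let isB i w : `|isigma sigma i w| <= A.
Proof.
have -> : isigma sigma i w = (sigma i w)^-1 by rewrite /isigma; field; exact: sN0.
by have /andP[? ?] := iB i w; rewrite ger0_norm.
Qed.

Let meanB (a : R) (x : nat -> R) N : (forall i, 0 <= x i <= a) ->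
  0 <= N%:R^-1 * \sum_(i < N) x i <= a.
Proof.
move=> xa; have a0 : 0 <= a by have /andP[h1 h2] := xa 0%N; exact: le_trans h2.
rewrite mulr_ge0 ?sumr_ge0//=; last by move=> i _; have /andP[] := xa i.
case: N => [|n]; first by rewrite big_ord0 mulr0.
rewrite mulrC ler_pdivrMr// mulr_natr -[X in _ *+ X]card_ord -sumr_const.
by apply: ler_sum => i _; have /andP[] := xa i.
Qed.

Let sbarB N w : 0 <= sinvbar N sigma w <= A.
Proof. by apply: (meanB (x := fun i => (sigma i w)^-1)). Qed.

Let ssbar N : smeas sigma eta (sinvbar N sigma).
Proof.
move=> j t; apply: omeasM; first exact: omeas_cst.
by apply: omeas_sum => i; exact: si.
Qed.

Let sdem N i : smeas sigma eta (demeaned sigma N i).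
Proof.
move=> j t; apply: omeasM; first exact: ss.
by apply: omeasB; [exact: si|exact: ssbar].
Qed.

Let b := M * A.

Let demB N i w : `|demeaned sigma N i w| <= b.
Proof.
rewrite normrM ler_pM//.
have /andP[? ?] := iB i w; have /andP[? ?] := sbarB N w.
by rewrite ler_norml; apply/andP; split; lra.
Qed.

(** * The remainder in L^1 *)

Let remainder_pt N T w : (0 < N)%N -> `|remainder sigma eta N T w| <=
  cdscale N T * \sum_(t < T) (2 * N%:R)^-1 * ((1 + A ^+ 2) * lin eta sigma N t w ^+ 2
    + lin eta (isigma sigma) N t w ^+ 2).
Proof.
move=> N0; have n0 : 0 < N%:R :> R by rewrite ltr0n.
rewrite /remainder normrM (ger0_norm (cdscale_ge0 N T)) ler_wpM2l ?cdscale_ge0//.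
apply: le_trans (ler_norm_sum _ _ _) _; apply: ler_sum => t _.
set S := lin eta sigma N t w; set U := lin eta _ N t w; set q := \sum_(i < N) _.
have /andP[q0 qA] : 0 <= q <= N%:R * A ^+ 2.
  rewrite /q sumr_ge0/=; last by move=> i _; exact: sqr_ge0.
  rewrite mulr_natl -[X in _ *+ X](card_ord N) -sumr_const; apply: ler_sum => i _.
  by have /andP[i0 iA] := iB i w; rewrite lerXn2r// nnegrE// ltW.
apply: le_trans (ler_normB _ _) _.
(* Replacing the product by squares leaves only the second moments of linear forms, each of order
   [N]. *)
have h1 : `|S / N%:R * U| <= (2 * N%:R)^-1 * (S ^+ 2 + U ^+ 2).
  rewrite (_ : S / N%:R * U = (2 * N%:R)^-1 * (2 * S * U)); last by field; rewrite gt_eqF.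
  rewrite normrM ger0_norm ?invr_ge0 ?mulr_ge0 ?ler_wpM2l ?invr_ge0 ?mulr_ge0//.
  by rewrite ler_norml; apply/andP; split; [have := sqr_ge0 (S + U)|have := sqr_ge0 (S - U)]; nra.
have h2 : `|(S / N%:R) ^+ 2 * q / 2| <= (2 * N%:R)^-1 * (A ^+ 2 * S ^+ 2).
  rewrite ger0_norm; last by rewrite divr_ge0// mulr_ge0// sqr_ge0.
  rewrite (_ : (S / N%:R) ^+ 2 * q / 2 = (2 * N%:R)^-1 * (S ^+ 2 / N%:R * q)); last first.
    by field; rewrite gt_eqF.
  rewrite ler_wpM2l ?invr_ge0 ?mulr_ge0//.
  have sn : 0 <= S ^+ 2 / N%:R by rewrite divr_ge0 ?sqr_ge0.
  apply: le_trans (ler_wpM2l sn qA) _.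
  by rewrite le_eqVlt; apply/orP; left; apply/eqP; field; rewrite gt_eqF.
apply: le_trans (lerD h1 h2) _.
by rewrite le_eqVlt; apply/orP; left; apply/eqP; ring.
Qed.

Let lin1L N t : Lp P 8 (lin eta sigma N t). Proof. exact: (lin_Lp8 mvars eta8L ss sB). Qed.

Let lin2L N t : Lp P 8 (lin eta (isigma sigma) N t).
Proof. exact: (lin_Lp8 mvars eta8L sis isB). Qed.

Let intg_pt N T : intg P (fun w => cdscale N T *
  \sum_(t < T) (2 * N%:R)^-1 * ((1 + A ^+ 2) * lin eta sigma N t w ^+ 2
    + lin eta (isigma sigma) N t w ^+ 2)).
Proof.
apply: intgZ; apply: intg_sum => t; apply: intgZ; apply: intgD; first apply: intgZ.
  by apply: Lp1_intg; apply: LpX; exact: Lp_le (lin1L N t).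
by apply: Lp1_intg; apply: LpX; exact: Lp_le (lin2L N t).
Qed.

Let mremainder N T : measurable_fun setT (remainder sigma eta N T).
Proof.
have mi i : measurable_fun setT (fun w => (sigma i w)^-1).
  exact: (omeas_meas mvars (@si i 0%N 0%N)).
apply: measurable_funM => //; apply: measurable_sum => t; apply: measurable_funB.
  apply: measurable_funM; last exact: Lp_meas (lin2L N t).
  by apply: measurable_funM => //; exact: Lp_meas (lin1L N t).
apply: measurable_funM => //; apply: measurable_funM.
  apply: measurable_funX; apply: measurable_funM => //; exact: Lp_meas (lin1L N t).
by apply: measurable_sum => i; exact: measurable_funX.
Qed.

Lemma remainder_intg N T : intg P (remainder sigma eta N T).
Proof.
have [->|N0] := posnP N; last first.
  exact: (intg_le (@mremainder N T) (intg_pt N T) (fun w => @remainder_pt N T w N0)).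
rewrite (_ : remainder _ _ _ _ = fun=> 0); first exact: intg_cst.
apply/funext => w; rewrite /remainder big1 ?mulr0// => t _.
by rewrite /lin !big_ord0 !mul0r expr0n/= !mul0r subrr.
Qed.

Lemma remainder_bound : exists2 K : R, 0 < K & forall N T, (1 < N)%N -> (0 < T)%N ->
  Ex P (fun w => `|remainder sigma eta N T w|) <= K * (Num.sqrt T%:R / N%:R).
Proof.
(* Twice the bound per period: the form weighted by [sigma] has second moment at most [M^2 N], the
   one weighted by [isigma] at most [A^2 N]. *)
pose K := (1 + A ^+ 2) * M ^+ 2 + A ^+ 2.
have A20 : 0 < A ^+ 2 by rewrite exprn_gt0.
have K0 : 0 < K by rewrite addr_gt0// mulr_gt0// ?exprn_gt0// addr_gt0.
exists K => // N T N1 T0.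
have N0 : (0 < N)%N := ltnW N1.
have n0 : 0 < N%:R :> R by rewrite ltr0n.
have E1 t := Ex_lin2 mvars indep eta8L Eeta Eeta2 ss sB N t.
have E2 t := Ex_lin2 mvars indep eta8L Eeta Eeta2 sis isB N t.
have i1 t : intg P (fun w => lin eta sigma N t w ^+ 2).
  by apply: Lp1_intg; apply: LpX; exact: Lp_le (lin1L N t).
have i2 t : intg P (fun w => lin eta (isigma sigma) N t w ^+ 2).
  by apply: Lp1_intg; apply: LpX; exact: Lp_le (lin2L N t).
apply: le_trans (Ex_le (intg_abs (remainder_intg N T)) (intg_pt N T)
  (fun w => @remainder_pt N T w N0)) _.
rewrite ExZ; last first.
  by apply: intg_sum => t; apply: intgZ; apply: intgD => //; exact: intgZ.
rewrite Ex_sum; last by move=> t; apply: intgZ; apply: intgD => //; exact: intgZ.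
apply: le_trans (_ : cdscale N T * \sum_(t < T) K / 2 <= _).
  apply: ler_wpM2l; first exact: cdscale_ge0.
  apply: ler_sum => t _; rewrite ExZ; last by apply: intgD => //; exact: intgZ.
  rewrite ExD//; last exact: intgZ.
  rewrite ExZ//.
  have -> : K / 2 = (2 * N%:R)^-1 * ((1 + A ^+ 2) * (M ^+ 2 * N%:R) + A ^+ 2 * N%:R).
    by rewrite /K; field; rewrite gt_eqF.
  apply: ler_wpM2l; first by rewrite invr_ge0 mulr_ge0.
  by apply: lerD => //; apply: ler_wpM2l => //; rewrite addr_ge0// ltW.
rewrite sumr_const card_ord -[K / 2 *+ T]mulr_natr.
have := ler_wpM2l (ltW K0) (@cdscale_le R N T N1 T0).
set z := Num.sqrt T%:R / N%:R; set c := cdscale N T; lra.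
Qed.

(** * Limit of the conditional variance *)

Let alpha := Ex P (fun w => (sigma 0%N w)^-1).
Let beta := Ex P (sigma 0%N).
Let gamma := Ex P (fun w => sigma 0%N w ^+ 2).
(** This is [E[(1 - alpha * sigma)^2]], the limit of the averages of [g_i^2]; its square is
    [Omega]. *)
Let mu := 1 - 2 * beta * alpha + gamma * alpha ^+ 2.

Let avg (x : nat -> Om -> R) N w := N%:R^-1 * \sum_(i < N) x i w.

Let inl_inj : injective (inl : nat -> (nat + nat * nat)%type).
Proof. by move=> i j []. Qed.

Let lln (u : R -> R) (a : R) e : measurable_fun setT u ->
  (forall i w, `|u (sigma i w)| <= a) -> 0 < e ->
  exists N0, forall N, (N0 <= N)%N ->
  Ex P (fun w => `|avg (fun i w => u (sigma i w)) N w - Ex P (fun w => u (sigma 0%N w))|) <= e.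
Proof. by move=> mu' ua e0; exact: (lln_L1 mvars indep inl_inj mu' ua idsigma e0). Qed.

Let lln_inv e : 0 < e -> exists N0, forall N, (N0 <= N)%N ->
  Ex P (fun w => `|sinvbar N sigma w - alpha|) <= e.
Proof.
move=> e0; have [i w|N0 hN] := @lln tinv A e mtinv _ e0.
  by rewrite tinvE; have /andP[? ?] := iB i w; rewrite ger0_norm.
have E1 : Ex P (fun w => tinv (sigma 0%N w)) = alpha.
  by congr (Ex P _); apply/funext => w; exact: tinvE.
have E2 N w : avg (fun i w => tinv (sigma i w)) N w = sinvbar N sigma w.
  by rewrite /avg /sinvbar; under eq_bigr do rewrite tinvE.
by exists N0 => N /hN; rewrite E1; under [X in Ex _ X]eq_fun do rewrite E2.
Qed.

Let lln_id e : 0 < e -> exists N0, forall N, (N0 <= N)%N ->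
  Ex P (fun w => `|avg sigma N w - beta|) <= e.
Proof. by move=> e0; exact: (@lln id M e _ sB e0). Qed.

Let sqB i w : 0 <= sigma i w ^+ 2 <= M ^+ 2.
Proof.
by rewrite sqr_ge0/= -(real_normK (num_real (sigma i w))) lerXn2r// nnegrE// ltW.
Qed.

Let lln_sqr e : 0 < e -> exists N0, forall N, (N0 <= N)%N ->
  Ex P (fun w => `|avg (fun i w => sigma i w ^+ 2) N w - gamma|) <= e.
Proof.
move=> e0; apply: (@lln (fun x => x ^+ 2) (M ^+ 2) e _ _ e0); first exact: measurable_funX.
by move=> i w; have /andP[? ?] := sqB i w; rewrite ger0_norm.
Qed.

Let Ex01 (x : Om -> R) a : measurable_fun setT x -> (forall w, 0 <= x w <= a) -> 0 <= Ex P x <= a.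
Proof.
move=> mx xa; rewrite Ex_ge0/=; last by move=> w; have /andP[] := xa w.
rewrite -(Ex_cst P a); apply: Ex_le; [|exact: intg_cst|by move=> w; have /andP[] := xa w].
by apply: (@intg_bounded _ _ _ P _ a) => // w; have /andP[? ?] := xa w; rewrite ger0_norm.
Qed.

Let minv i : measurable_fun setT (fun w => (sigma i w)^-1).
Proof. exact: (omeas_meas mvars (@si i 0%N 0%N)). Qed.

(** [D] bounds [|m + mu|] in the difference of the squares of [m], the average of the [g_i^2], and
    [mu]; [L1] is a Lipschitz constant of [m] in the average of the [1 / sigma_i]. *)
Let D := b ^+ 2 + `|mu|.
Let L1 := 2 * M + 2 * A * M ^+ 2.

Let variance_pt N w : (1 < N)%N ->
  `|2 / (N%:R * (N%:R - 1)) * qvar (demeaned sigma N) N w - mu ^+ 2| <=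
  b ^+ 4 / (N%:R - 1) + D * (L1 * `|sinvbar N sigma w - alpha| +
    2 * A * `|avg sigma N w - beta| + A ^+ 2 * `|avg (fun i w => sigma i w ^+ 2) N w - gamma|).
Proof.
move=> N1.
have n1 : 0 < N%:R - 1 :> R by rewrite subr_gt0 ltr1n.
have n0 : 0 < N%:R :> R by rewrite ltr0n ltnW.
have nN : N%:R != 0 :> R by rewrite gt_eqF.
have nN1 : N%:R - 1 != 0 :> R by rewrite gt_eqF.
pose g i := demeaned sigma N i w.
pose m := N%:R^-1 * \sum_(i < N) g i ^+ 2.
pose q := N%:R^-1 * \sum_(i < N) (g i ^+ 2) ^+ 2.
have b0 : 0 <= b by rewrite mulr_ge0// ltW.
have gb i : 0 <= g i ^+ 2 <= b ^+ 2.
  by rewrite sqr_ge0/= -(real_normK (num_real (g i))) lerXn2r// ?nnegrE//; exact: demB.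
have /andP[m0 mb] : 0 <= m <= b ^+ 2 by exact: (meanB (x := fun i => g i ^+ 2)).
have /andP[q0 qb] : 0 <= q <= b ^+ 4.
  apply: (meanB (x := fun i => (g i ^+ 2) ^+ 2)) => i.
  have /andP[g0 g1] := gb i; rewrite sqr_ge0/= (_ : b ^+ 4 = (b ^+ 2) ^+ 2).
    by rewrite lerXn2r// nnegrE sqr_ge0.
  by rewrite -exprM.
(* By [pair_sum], the diagonal costs only a term of order [1 / (N - 1)]. *)
have -> : 2 / (N%:R * (N%:R - 1)) * qvar (demeaned sigma N) N w = m ^+ 2 + (m ^+ 2 - q) / (N%:R - 1).
  rewrite /qvar (pair_sum N (fun i => g i ^+ 2)) /m /q.
  set z1 := \sum_(i < N) _; set z2 := \sum_(i < N) _.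
  by field; rewrite nN nN1.
set abar := sinvbar N sigma w; set sb := avg sigma N w; set qb' := avg _ N w.
have mE : m = 1 - 2 * abar * sb + abar ^+ 2 * qb'.
  rewrite /m (eq_bigr (fun i : 'I_N => 1 - 2 * abar * sigma i w + abar ^+ 2 * sigma i w ^+ 2)).
    rewrite big_split sumrB/= sumr_const card_ord -!mulr_sumr /sb /qb' /avg.
    set z1 := \sum_(i < N) _; set z2 := \sum_(i < N) _.
    by field.
  by move=> i _; rewrite /g /demeaned -/abar; field; exact: sN0.
have /andP[ab0 abA] : 0 <= abar <= A by exact: sbarB.
have /andP[sb0 sbM] : 0 <= sb <= M.
  by apply: (meanB (x := fun i => sigma i w)) => i; rewrite ltW//=; have /andP[] := sigmaB i w.
have /andP[qb0 qbM] : 0 <= qb' <= M ^+ 2.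
  by apply: (meanB (x := fun i => sigma i w ^+ 2)) => i.
have /andP[al0 alA] : 0 <= alpha <= A by apply: Ex01.
have h1 : `|(m ^+ 2 - q) / (N%:R - 1)| <= b ^+ 4 / (N%:R - 1).
  rewrite normrM normfV (gtr0_norm n1) ler_wpM2r ?invr_ge0 ?(ltW n1)//.
  have m2 : m ^+ 2 <= b ^+ 4.
    rewrite (_ : b ^+ 4 = (b ^+ 2) ^+ 2); first by rewrite lerXn2r// nnegrE sqr_ge0.
    by rewrite -exprM.
  rewrite ler_norml; apply/andP; split.
    by apply: le_trans (_ : - q <= _); rewrite ?lerN2// lerDr sqr_ge0.
  by apply: le_trans m2; rewrite gerBl.
have h2 : `|m - mu| <= L1 * `|abar - alpha| + 2 * A * `|sb - beta| + A ^+ 2 * `|qb' - gamma|.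
  (* The three averages are replaced by their means one at a time. *)
  have -> : m - mu = (- 2 * sb + (abar + alpha) * qb') * (abar - alpha) +
      (- 2 * alpha) * (sb - beta) + alpha ^+ 2 * (qb' - gamma).
    by rewrite mE /mu; ring.
  apply: le_trans (ler_normD _ _) (lerD _ _); last first.
    by rewrite normrM ler_wpM2r// ger0_norm ?sqr_ge0// lerXn2r// nnegrE// ltW.
  apply: le_trans (ler_normD _ _) (lerD _ _); last first.
    by rewrite normrM ler_wpM2r// mulNr normrN ger0_norm ?mulr_ge0// ler_wpM2l.
  rewrite normrM ler_wpM2r//; apply: le_trans (ler_normD _ _) _; rewrite /L1; apply: lerD.
    rewrite mulNr normrN ger0_norm; last exact: (mulr_ge0 (ler0n _ 2) sb0).
    by apply: ler_wpM2l.
  rewrite ger0_norm; last by rewrite mulr_ge0// addr_ge0.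
  apply: ler_pM => //; first by rewrite addr_ge0.
  by rewrite mulr2n mulrDl !mul1r lerD.
have h3 : `|m ^+ 2 - mu ^+ 2| <= D * `|m - mu|.
  rewrite subr_sqr normrM mulrC ler_wpM2r//; apply: le_trans (ler_normD _ _) _.
  by rewrite ger0_norm// lerD2r.
have -> : m ^+ 2 + (m ^+ 2 - q) / (N%:R - 1) - mu ^+ 2 = (m ^+ 2 - q) / (N%:R - 1) + (m ^+ 2 - mu ^+ 2).
  by ring.
apply: le_trans (ler_normD _ _) (lerD h1 _); apply: le_trans h3 _.
by rewrite ler_wpM2l// addr_ge0// sqr_ge0.
Qed.

Let iinv i : intg P (fun w => (sigma i w)^-1).
Proof.
by apply: (@intg_bounded _ _ _ P _ A) => // w; have /andP[? ?] := iB i w; rewrite ger0_norm.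
Qed.

Let isig i : intg P (sigma i). Proof. exact: (@intg_bounded _ _ _ P _ M). Qed.

Let isig2 i : intg P (fun w => sigma i w ^+ 2).
Proof.
apply: (@intg_bounded _ _ _ P _ (M ^+ 2)); first exact: measurable_funX.
by move=> w; have /andP[? ?] := sqB i w; rewrite ger0_norm.
Qed.

Let iavg (x : nat -> Om -> R) N a : (forall i, intg P (x i)) ->
  intg P (fun w => `|avg x N w - a|).
Proof.
move=> ix; apply: intg_abs; apply: intgB; last exact: intg_cst.
by apply: intgZ; exact: intg_sum.
Qed.

Let b0 : 0 <= b. Proof. by rewrite mulr_ge0// ltW. Qed.

Let gLp N := @qvar_Lp _ _ _ P sigma eta mvars (demeaned sigma N) b (@sdem N) (@demB N).

Lemma variance_cvg e : 0 < e -> exists N0, forall N, (N0 <= N)%N ->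
  Ex P (fun w => `|2 / (N%:R * (N%:R - 1)) * qvar (demeaned sigma N) N w - mu ^+ 2|) <= e.
Proof.
move=> e0; pose L := L1 + 2 * A + A ^+ 2.
have A20 : 0 <= A ^+ 2 by exact: sqr_ge0.
have L10 : 0 <= L1.
  apply: addr_ge0; first by apply: mulr_ge0 => //; exact: ltW.
  by apply: mulr_ge0; last exact: sqr_ge0; apply: mulr_ge0 => //; exact: ltW.
have D0 : 0 <= D by apply: addr_ge0 => //; exact: sqr_ge0.
have A20' : 0 <= 2 * A by rewrite mulr_ge0// ltW.
have L0 : 0 <= L by apply: addr_ge0 => //; exact: addr_ge0.
(* The added 1 keeps the denominator positive when [D * L] vanishes. *)
pose e' := e / 2 / (D * L + 1).
have DL : 0 < D * L + 1 by rewrite ltr_wpDl// mulr_ge0.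
have e'0 : 0 < e' by apply: divr_gt0 => //; exact: divr_gt0.
have [N1 h1] := lln_inv e'0; have [N2 h2] := lln_id e'0; have [N3 h3] := lln_sqr e'0.
have [N4 hN4] : exists n : nat, 2 * b ^+ 4 / e + 2 <= n%:R.
  by have [n _ h] := nbhs_infty_ger (2 * b ^+ 4 / e + 2); exists n; exact: (h n (leqnn n)).
exists (maxn (maxn N1 N2) (maxn N3 (maxn N4 2))) => N.
rewrite !geq_max => /andP[/andP[n1 n2] /andP[n3 /andP[n4 N2']]].
have nN : 2 * b ^+ 4 / e + 2 <= N%:R by apply: le_trans hN4 _; rewrite ler_nat.
have b40 : 0 <= b ^+ 4 by rewrite exprn_ge0.
have be : 0 <= 2 * b ^+ 4 / e by rewrite divr_ge0// ?mulr_ge0// ltW.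
have np : 0 < N%:R - 1 :> R by move: nN be; lra.
have k1 : intg P (fun w => `|sinvbar N sigma w - alpha|).
  exact: (@iavg (fun i w => (sigma i w)^-1) N alpha iinv).
have k2 : intg P (fun w => `|avg sigma N w - beta|) by exact: iavg.
have k3 : intg P (fun w => `|avg (fun i w => sigma i w ^+ 2) N w - gamma|) by exact: iavg.
have j1 := intgZ L1 k1; have j2 := intgZ (2 * A) k2; have j3 := intgZ (A ^+ 2) k3.
have j4 := intgD (intgD j1 j2) j3.
apply: le_trans (Ex_le _ _ (fun w => @variance_pt N w N2')) _.
- apply: intg_abs; apply: intgB; last exact: intg_cst.
  by apply: intgZ; exact: Lp1_intg (gLp N N 1%N).
- by apply: intgD; [exact: intg_cst|exact: intgZ].
rewrite ExD; [|exact: intg_cst|exact: intgZ].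
rewrite Ex_cst ExZ// ExD//; last exact: intgD.
rewrite ExD// !ExZ//.
have t1 : b ^+ 4 / (N%:R - 1) <= e / 2.
  rewrite ler_pdivrMr//; have : e / 2 * (2 * b ^+ 4 / e) <= e / 2 * (N%:R - 1).
    by rewrite ler_wpM2l ?divr_ge0 ?(ltW e0)//; move: nN; lra.
  by rewrite (_ : e / 2 * (2 * b ^+ 4 / e) = b ^+ 4)//; field; rewrite gt_eqF.
have t2 : D * (L * e') <= e / 2.
  rewrite mulrA /e' mulrCA; apply: le_trans (_ : e / 2 * 1 <= _); last by rewrite mulr1.
  apply: ler_wpM2l; first by rewrite divr_ge0// ltW.
  by rewrite ler_pdivrMr// mul1r lerDl.
rewrite [e]splitr; apply: lerD t1 _; apply: le_trans t2; apply: ler_wpM2l => //.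
have -> : L * e' = L1 * e' + 2 * A * e' + A ^+ 2 * e' by rewrite /L; ring.
by apply: lerD; [apply: lerD|]; apply: ler_wpM2l => //; [exact: h1|exact: h2|exact: h3].
Qed.

(** * Stein's identity for the lead term *)

Let W N T := wsum eta (demeaned sigma N) N (cdscale N T) T.

Let WL N T : Lp P 4 (W N T).
Proof. exact: (wsum_Lp4 mvars eta8L (@sdem N) (@demB N)). Qed.

Let W2E N T : (1 < N)%N -> (0 < T)%N -> Ex P (fun w => W N T w ^+ 2) =
  Ex P (fun w => 2 / (N%:R * (N%:R - 1)) * qvar (demeaned sigma N) N w).
Proof.
move=> N1 T0; rewrite (Ex_wsum2 mvars indep eta8L Eeta Eeta2 (@sdem N) (@demB N)).
by rewrite cdscale_sqr// ExZ//; exact: Lp1_intg (gLp N N 1%N).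
Qed.

Lemma wsum_second_moment e : 0 < e -> exists N0, forall N T, (N0 <= N)%N -> (0 < T)%N ->
  Ex P (fun w => W N T w ^+ 2) <= mu ^+ 2 + e.
Proof.
move=> e0; have [N0 h] := variance_cvg e0; exists (maxn N0 2) => N T.
rewrite geq_max => /andP[n0 n2] T0; rewrite W2E//.
have i1 : intg P (fun w => 2 / (N%:R * (N%:R - 1)) * qvar (demeaned sigma N) N w).
  by apply: intgZ; exact: Lp1_intg (gLp N N 1%N).
rewrite -lerBlDl -{1}(Ex_cst P (mu ^+ 2)) -ExB//; last exact: intg_cst.
apply: le_trans (h N n0); apply: le_trans (ler_norm _) _.
apply: Ex_abs; apply: intgB => //; exact: intg_cst.
Qed.

Lemma wsum_stein (f f' : R -> R) : (forall x : R, is_derive x 1 f (f' x)) ->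
  continuous f' -> (exists B, forall x, B <= `|x| -> f x = 0 /\ f' x = 0) ->
  forall e, 0 < e -> exists N0, forall N T, (N0 <= N)%N -> (N0 <= T)%N ->
  `|Ex P (fun w => mu ^+ 2 * f' (W N T w) - W N T w * f (W N T w))| <= e.
Proof.
move=> df cf' [B hB] e e0.
have cf : continuous f.
  move=> x; apply: differentiable_continuous; apply/derivable1_diffP.
  by have [] := df x.
have [a1 a10 fa1] := csupp_bounded cf (fun x Bx => (hB x Bx).1).
have [a2 a20 fa2] := csupp_bounded cf' (fun x Bx => (hB x Bx).2).
pose a := a1 + a2.
have a0 : 0 <= a by rewrite addr_ge0.
have fa x : `|f x| <= a by rewrite (le_trans (fa1 x))// lerDl.
have f'a x : `|f' x| <= a by rewrite (le_trans (fa2 x))// lerDr.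
have b40 : 0 <= b ^+ 4 by rewrite exprn_ge0.
have b81 : 0 < 8 * b ^+ 4 + 1 by rewrite ltr_wpDl// mulr_ge0.
have e30 : 0 < e / 3 by rewrite divr_gt0.
(* Makes the first part of [stein_scale], [8 * e1 * b^4], at most [e / 3]. *)
pose e1 := e / 3 / (8 * b ^+ 4 + 1).
have e10 : 0 < e1 by rewrite divr_gt0.
have [C C0 hC] := csupp_modulus cf' (fun x Bx => (hB x Bx).2) e10.
have fU x y : `|f' (x + y) - f' x| <= e1 + C * y ^+ 2 by have [] := hC x y.
have fT := taylor_modulus C0 df fU.
have mf : measurable_fun setT f by exact: continuous_measurable_fun.
have mf' : measurable_fun setT f' by exact: continuous_measurable_fun.
pose K := quadC (1 + M) b + b ^+ 8.
have K0 : 0 <= K.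
  have M10 : 0 <= 1 + M by rewrite addr_ge0// ltW.
  have lC : 0 <= linC (1 + M) b.
    apply: addr_ge0; first by apply: mulr_ge0.
    by apply: mulr_ge0 => //; apply: mulr_ge0.
  apply: addr_ge0; last exact: exprn_ge0.
  by apply: mulr_ge0 => //; apply: mulr_ge0 => //; apply: mulr_ge0.
have e20 : 0 < e / 3 / (a + 1) by rewrite divr_gt0// ltr_wpDl.
have [N1 hN1] := variance_cvg e20.
(* [C] comes from the modulus of [f'] at level [e1] and does not depend on [N] or [T], so [T] can be
   taken large after it. *)
have [T1 hT1] : exists n : nat, 16 * (C * K) / (e / 3) <= n%:R.
  by have [n _ h] := nbhs_infty_ger (16 * (C * K) / (e / 3)); exists n; exact: (h n (leqnn n)).
exists (maxn (maxn N1 2) (maxn T1 1)) => N T.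
rewrite !geq_max => /andP[/andP[n1 n2] _] /andP[_ /andP[t1 t0]].
have T0 : 0 < T%:R :> R by rewrite ltr0n.
pose w0 := W N T; pose c := @cdscale R N T.
have mW : measurable_fun setT w0 := Lp_meas (WL N T).
have key := stein_bound mvars indep eta8L Eeta Eeta2 Eeta4 (@sdem N) (@demB N) N T c
  mf mf' fa f'a (ltW e10) C0 fT fU.
have sc := @stein_scale R N T n2 t0 e1 (b ^+ 4) C K (ltW e10) b40 C0 K0.
pose V w := 2 / (N%:R * (N%:R - 1)) * qvar (demeaned sigma N) N w.
have VE w : c ^+ 2 * T%:R * qvar (demeaned sigma N) N w = V w by rewrite /c cdscale_sqr.
have VL p : Lp P p V by apply: LpZ; exact: gLp.
have uL (u : R -> R) (Z : Om -> R) : measurable_fun setT u -> (forall x, `|u x| <= a) ->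
    Lp P 1 Z -> intg P (fun w => Z w * u (w0 w)).
  move=> mu' ua ZL; under [X in intg _ X]eq_fun do rewrite mulrC.
  apply: Lp1_intg; apply: (LpMb _ (fun w => ua (w0 w)) ZL).
  exact: measurableT_comp.
have W1 : Lp P 1 w0 := Lp_le (isT : (1 <= 4)%N) (WL N T).
have i1 := uL f' V mf' f'a (VL 1%N).
have i2 := uL f w0 mf fa W1.
have m1 : Lp P 1 (fun w => mu ^+ 2 - V w).
  apply: LpD; first by apply: (@Lp_bounded _ _ _ P 1 _ `|mu ^+ 2|).
  by under [X in Lp _ _ X]eq_fun do rewrite -mulN1r; apply: LpZ.
have i3 := uL f' _ mf' f'a m1.
have -> : Ex P (fun w => mu ^+ 2 * f' (w0 w) - w0 w * f (w0 w)) =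
    Ex P (fun w => (mu ^+ 2 - V w) * f' (w0 w)) -
    (Ex P (fun w => w0 w * f (w0 w)) - Ex P (fun w => V w * f' (w0 w))).
  rewrite opprB addrA -ExD// -ExB//; last exact: intgD.
  by congr Ex; apply/funext => w; ring.
have b1 : `|Ex P (fun w => (mu ^+ 2 - V w) * f' (w0 w))| <= e / 3.
  have iV : intg P (fun w => `|V w - mu ^+ 2|).
    by apply: intg_abs; apply: intgB; [exact: Lp1_intg (VL 1%N)|exact: intg_cst].
  apply: le_trans (_ : Ex P (fun w => a * `|V w - mu ^+ 2|) <= _).
    apply: Ex_abs_le; [exact: intg_meas i3|exact: intgZ|].
    by move=> w; rewrite normrM distrC mulrC ler_wpM2r.
  rewrite ExZ//; apply: le_trans (ler_wpM2l a0 (hN1 N n1)) _.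
  have a10' : 0 < a + 1 by rewrite ltr_wpDl.
  rewrite mulrCA; apply: le_trans (_ : e / 3 * 1 <= _); last by rewrite mulr1.
  apply: ler_wpM2l; first exact: ltW.
  by rewrite ler_pdivrMr// mul1r lerDl.
have b2 : `|Ex P (fun w => w0 w * f (w0 w)) - Ex P (fun w => V w * f' (w0 w))| <= e / 3 + e / 3.
  rewrite -(_ : (fun w => c ^+ 2 * T%:R * qvar (demeaned sigma N) N w * f' (w0 w)) =
    (fun w => V w * f' (w0 w))); last by apply/funext => w; rewrite VE.
  apply: le_trans key _; apply: le_trans sc _; apply: lerD.
    rewrite (_ : 8 * (e1 * b ^+ 4) = e / 3 * (8 * b ^+ 4 / (8 * b ^+ 4 + 1))); last first.
      by rewrite /e1; ring.
    apply: le_trans (_ : e / 3 * 1 <= _); last by rewrite mulr1.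
    apply: ler_wpM2l; first exact: ltW.
    by rewrite ler_pdivrMr// mul1r lerDl.
  rewrite ler_pdivrMr// [e / 3 * _]mulrC -ler_pdivrMr//.
  by apply: le_trans hT1 _; rewrite ler_nat.
apply: le_trans (ler_normB _ _) _; apply: le_trans (lerD b1 b2) _.
by rewrite le_eqVlt; apply/orP; left; apply/eqP; field.
Qed.

(** * The expansion and the limit law *)

Lemma remainder_OP e : 0 < e -> exists K : R, 0 < K /\ exists N0 : nat,
  forall N T : nat, (N0 <= N)%N -> (N0 <= T)%N ->
  (P [set w | (K * (Num.sqrt T%:R / N%:R) <
     `| CDstat N T tau sigma eta w - CDlead N T sigma eta w
        - Num.sqrt T%:R * Xi N T sigma eta w |)%R] <= e%:E)%E.
Proof.
move=> e0; have [K K0 hK] := remainder_bound.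
exists (K / e); split; first by rewrite divr_gt0.
exists 2%N => N T n2 t2; have n1 : (0 < N)%N := ltnW n2; have t1 : (0 < T)%N := ltnW t2.
have r0 : 0 < Num.sqrt T%:R / N%:R :> R by rewrite divr_gt0 ?sqrtr_gt0 ?ltr0n.
have kr : 0 < K / e * (Num.sqrt T%:R / N%:R) by rewrite mulr_gt0// divr_gt0.
have := markov_Ex (intg_abs (remainder_intg N T)) (fun w => normr_ge0 _) kr.
rewrite (_ : [set w | _] = [set w | (K / e * (Num.sqrt T%:R / N%:R) <
  `|remainder sigma eta N T w|)%R]); last first.
  by apply/funext => w; rewrite /= remainderE.
move=> h; apply: le_trans h _; rewrite lee_fin ler_pdivrMr//.
by rewrite mulrA [e * (K / e)]mulrC divfK ?gt_eqF//; exact: hK.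
Qed.

Lemma CD_cvg_normal (Ns Ts : nat -> nat) :
  (forall B : nat, exists k0, forall k, (k0 <= k)%N -> (B <= Ns k)%N) ->
  (forall B : nat, exists k0, forall k, (k0 <= k)%N -> (B <= Ts k)%N) ->
  ((fun k => Num.sqrt (Ts k)%:R / (Ns k)%:R : R) @ \oo --> (0 : R)) ->
  cvg_in_distr_normal P
    (fun k w => CDstat (Ns k) (Ts k) tau sigma eta w
                - Num.sqrt (Ts k)%:R * Xi (Ns k) (Ts k) sigma eta w) (mu ^+ 2).
Proof.
move=> hNs hTs NT0.
have ev B : \forall k \near \oo, (B <= Ns k)%N /\ (B <= Ts k)%N.
  have [k1 h1] := hNs B; have [k2 h2] := hTs B.
  exists (maxn k1 k2) => // k; rewrite /= geq_max => /andP[? ?].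
  by split; [exact: h1|exact: h2].
pose Wk k := W (Ns k) (Ts k).
(* [remainderE] needs [N >= 2] and [T >= 1], so [Yk] is identified with [CD - sqrt T * Xi] only for
   large [k], which suffices for a limit. *)
pose Yk k w := Wk k w + remainder sigma eta (Ns k) (Ts k) w.
suff cY : cvg_in_distr_normal P Yk (mu ^+ 2).
  move=> g cg bg; have := cY g cg bg; apply: cvg_trans; apply: near_eq_cvg.
  apply: filterS (ev 2%N) => k [n2 t2]; apply: eq_integral => w _.
  congr (g _)%:E; rewrite /Yk /Wk /W -CDleadE -(remainderE eta tau n2 (ltnW t2))//.
  by ring.
have mWk k : measurable_fun setT (Wk k) := Lp_meas (WL _ _).
have mYk k : measurable_fun setT (Yk k).
  by apply: measurable_funD => //; exact: intg_meas (remainder_intg _ _).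
have iWk k : intg P (fun w => Wk k w ^+ 2).
  by apply: Lp1_intg; apply: LpX; exact: Lp_le (WL _ _).
have YWE k : (fun w => `|Yk k w - Wk k w|) = (fun w => `|remainder sigma eta (Ns k) (Ts k) w|).
  by apply/funext => w; rewrite /Yk addrAC subrr add0r.
have iYW k : intg P (fun w => `|Yk k w - Wk k w|).
  by rewrite YWE; apply: intg_abs; exact: remainder_intg.
have YW e : 0 < e -> \forall k \near \oo, Ex P (fun w => `|Yk k w - Wk k w|) <= e.
  move=> e0; have [K K0 hK] := remainder_bound.
  have eK : 0 < e / K by rewrite divr_gt0.
  have /cvgrPdist_le /(_ _ eK) hr := NT0.
  apply: filterS2 (ev 2%N) hr => k [n2 t2]; rewrite sub0r normrN => hk.
  rewrite YWE; apply: le_trans (hK _ _ n2 (ltnW t2)) _.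
  rewrite mulrC -ler_pdivlMr//; apply: le_trans hk; exact: ler_norm.
have W2 e : 0 < e -> \forall k \near \oo, Ex P (fun w => Wk k w ^+ 2) <= mu ^+ 2 + e.
  move=> e0; have [N0 hN] := wsum_second_moment e0.
  apply: filterS (ev (maxn N0 1)) => k; rewrite !geq_max => -[/andP[n0 _] /andP[_ t1]].
  exact: hN.
(* If [mu = 0] the limit is a point mass and [Wk] tends to 0 in L^2; otherwise Stein's equation
   applies with [s = |mu|]. *)
have [mu0|mu0] := eqVneq mu 0.
  rewrite mu0 expr0n; apply: (cvg_in_distr_normal0 mYk iWk iYW YW) => e e0.
  by apply: filterS (W2 e e0) => k; rewrite mu0 expr0n add0r.
have s0' : 0 < `|mu| by rewrite normr_gt0.
have -> : mu ^+ 2 = `|mu| ^+ 2 by rewrite real_normK// num_real.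
apply: (cvg_in_distr_normal_stein mYk mWk iWk iYW YW s0' (W2 1 ltr01)) => f f' df cf' fB e e0.
have [N0 hN] := wsum_stein df cf' fB e0.
apply: filterS (ev N0) => k [n0 t0].
by rewrite real_normK ?num_real//; exact: hN.
Qed.

End assumption.

Theorem theorem1 (R : realType) (d : measure_display) (Om : measurableType d)
  (P : probability Om R) (sigma : nat -> Om -> R) (eta : nat -> nat -> Om -> R)
  (tau : nat -> R) (delta M : R) :
  (* Assumption 1 (1): eta_{i,t} i.i.d., mean 0, variance 1, E[eta^8] < M *)
  (forall i t, measurable_fun setT (eta i t)) ->
  (forall i t, ident_distr P (eta i t) (eta 0%N 0%N)) ->
  (forall i t, (\int[P]_w (eta i t w)%:E = 0)%E) ->
  (forall i t, (\int[P]_w (eta i t w ^+ 2)%:E = 1)%E) ->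
  (forall i t, (\int[P]_w (eta i t w ^+ 8)%:E < M%:E)%E) ->
  (* Assumption 1 (2): sigma_i in [delta, M], i.i.d., independent of eta *)
  0 < delta -> delta < M ->
  (forall i, measurable_fun setT (sigma i)) ->
  (forall i w, delta <= sigma i w <= M) ->
  (forall i, ident_distr P (sigma i) (sigma 0%N)) ->
  (* joint mutual independence of (sigma_i)_i and (eta_{i,t})_{i,t} *)
  mutually_independent P
    (fun k : (nat + (nat * nat))%type =>
       match k with inl i => sigma i | inr it => eta it.1 it.2 end) ->
  (* (i) CD = lead + sqrt T * Xi + O_P(sqrt T / N) as N, T -> oo *)
  (forall e : R, 0 < e -> exists K : R, 0 < K /\ exists N0 : nat,
     forall N T : nat, (N0 <= N)%N -> (N0 <= T)%N ->
     (P [set w | (K * (Num.sqrt T%:R / N%:R) <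
         `| CDstat N T tau sigma eta w - CDlead N T sigma eta w
            - Num.sqrt T%:R * Xi N T sigma eta w |)%R] <= e%:E)%E)
  /\
  (* (ii) CD - sqrt T * Xi -> N(0, Omega) in distribution, along every joint
     path N, T -> oo with sqrt T / N -> 0 *)
  (let Omega :=
     (1 - 2 * Ex P (sigma 0%N) * Ex P (fun w => (sigma 0%N w)^-1)
        + Ex P (fun w => sigma 0%N w ^+ 2)
          * (Ex P (fun w => (sigma 0%N w)^-1)) ^+ 2) ^+ 2 in
   forall Ns Ts : nat -> nat,
     (forall B : nat, exists k0, forall k, (k0 <= k)%N -> (B <= Ns k)%N) ->
     (forall B : nat, exists k0, forall k, (k0 <= k)%N -> (B <= Ts k)%N) ->
     ((fun k => Num.sqrt (Ts k)%:R / (Ns k)%:R : R) @ \oo --> (0 : R)) ->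
     cvg_in_distr_normal P
       (fun k w => CDstat (Ns k) (Ts k) tau sigma eta w
                   - Num.sqrt (Ts k)%:R * Xi (Ns k) (Ts k) sigma eta w)
       Omega).
Proof.
move=> meta _ eta1 eta2 eta8 delta0 deltaM msigma sigmaB idsigma indep; split.
  by move=> e e0; apply: (remainder_OP tau meta eta1 eta2 eta8 delta0 deltaM msigma sigmaB indep e0).
move=> Omega Ns Ts hNs hTs NT.
exact: (CD_cvg_normal tau meta eta1 eta2 eta8 delta0 deltaM msigma sigmaB idsigma indep hNs hTs NT).
Qed.
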